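(* Let $E\subset[0,1]^2$ be a self-affine carpet, that is, the attractor of an iterated function system $\{S_1,\dots,S_m\}$ in the extended Lalley-Gatzouras class or in the Barański class, with $S_i(x,y)=(c_ix,d_iy)+(a_i,b_i)$, $c_i,d_i\in(0,1)$ for $1\le i\le m$, and $c_i\ne d_i$ for at least one $i$. Then $$\dim_{qA}E=\dim_AE\qquad\text{and}\qquad\dim_{qL}E=\dim_LE.$$
   Context: The attractor of an iterated function system (IFS) $\{S_1,\dots,S_m\}$ of contractions is the unique non-empty compact set $E$ with $E=\bigcup_{i=1}^mS_i(E)$. Barański class: divide the unit square $[0,1]^2$ into subrectangles by slicing it by finitely many (at least one in each direction) full horizontal and full vertical lines; select a subset of the resulting rectangles; for each selected rectangle the IFS contains the map $S_i$ of the form $(x,y)\mapsto(c_ix,d_iy)+(a_i,b_i)$, $c_i,d_i>0$, taking $[0,1]^2$ onto that rectangle. No restriction is imposed on the relative sizes of $c_i$ and $d_i$. Extended Lalley-Gatzouras class: divide the unit square into columns by finitely many (at least one) vertical lines, divide each column independently into rectangles by horizontal lines, and select a subset of the resulting rectangles, subject to the restriction that each selected rectangle has base at least as long as its height ($c_i\ge d_i$); the IFS consists, as before, of the maps $S_i(x,y)=(c_ix,d_iy)+(a_i,b_i)$ taking $[0,1]^2$ onto the selected rectangles. $B(x,R)$ denotes the ball with centre $x$ and radius $R$, and $N_r(A)$ is the least number of balls of radius $r$ needed to cover a bounded set $A$. For $0\le\delta<1$ let $\overline{h_E}(\delta)=\inf\{\alpha\ge0:\exists b,c>0$ such that $\max_{x\in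 E}N_r(E\cap B(x,R))\le c(R/r)^\alpha$ for all $0<r\le R^{1+\delta}\le R\le b\}$ and $\underline{h_E}(\delta)=\sup\{\alpha\ge0:\exists b,c>0$ such that $\min_{x\in E}N_r(E\cap B(x,R))\ge c(R/r)^\alpha$ for all $0<r\le R^{1+\delta}\le R\le b\}$. The Assouad and lower-Assouad dimensions are $\dim_AE=\overline{h_E}(0)$ and $\dim_LE=\underline{h_E}(0)$; the quasi-Assouad and quasi-lower Assouad dimensions are $\dim_{qA}E=\lim_{\delta\to0}\overline{h_E}(\delta)$ and $\dim_{qL}E=\lim_{\delta\to0}\underline{h_E}(\delta)$ (limits as $\delta\to0^+$ of monotone functions). *)

(* Defs.v *)
From HB Require Import structures.
From mathcomp Require Export all_boot all_order all_algebra.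
From mathcomp Require Export all_classical all_reals all_analysis.
Export Order.TTheory GRing.Theory Num.Theory.
Export numFieldNormedType.Exports.

Set Implicit Arguments.
Unset Strict Implicit.
Unset Printing Implicit Defensive.

Global Open Scope classical_set_scope.
Global Open Scope ring_scope.

Definition diag_affine (R : realType) (c d a b : R) (p : R * R) : R * R :=
  (c * p.1 + a, d * p.2 + b).

Definition unit_square (R : realType) : set (R * R) :=
  `[0, 1] `*` `[0, 1].

(* A subdivision 0 = s_0 < s_1 < ... < s_n = 1 is encoded by the sequence
   [:: s_1; ...; s_n] (the convention of itv_partition); it comes from n - 1
   cut points in ]0, 1[, and for j < n its j-th cell is [s_j, s_(j+1)]. *)
Definition cell (R : realType) (s : seq R) (j : nat) : set R :=
  `[nth 0 (0 :: s) j, nth 0 s j].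

(* sel i = (column, row) of the rectangle onto which the i-th map takes the
   unit square; sel is injective since a selected rectangle contributes
   exactly one map. *)
Definition baranski_class (R : realType) (m : nat) (c d a b : 'I_m -> R) :
    Prop :=
  (forall i, 0 < c i /\ 0 < d i) /\
  exists (s t : seq R) (sel : 'I_m -> nat * nat),
    [/\ itv_partition 0 1 s /\ (1 < size s)%N,
        itv_partition 0 1 t /\ (1 < size t)%N,
        injective sel &
        forall i,
          [/\ ((sel i).1 < size s)%N, ((sel i).2 < size t)%N &
              diag_affine (c i) (d i) (a i) (b i) @` @unit_square R =
              cell s (sel i).1 `*` cell t (sel i).2]].

(* t j is the subdivision of the j-th column; size (t j) = 1 means that this
   column is not cut. *)
Definition extended_lalley_gatzouras_class (R : realType) (m : nat)
    (c d a b : 'I_m -> R) : Prop :=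
  (forall i, 0 < c i /\ 0 < d i) /\
  exists (s : seq R) (t : nat -> seq R) (sel : 'I_m -> nat * nat),
    [/\ itv_partition 0 1 s /\ (1 < size s)%N,
        forall j, (j < size s)%N -> itv_partition 0 1 (t j),
        injective sel &
        forall i,
          [/\ ((sel i).1 < size s)%N,
              ((sel i).2 < size (t (sel i).1))%N,
              diag_affine (c i) (d i) (a i) (b i) @` @unit_square R =
              cell s (sel i).1 `*` cell (t (sel i).1) (sel i).2 &
              d i <= c i]].

Definition is_attractor (R : realType) (m : nat)
    (S : 'I_m -> R * R -> R * R) (E : set (R * R)) : Prop :=
  [/\ E !=set0, compact E & E = \bigcup_i (S i @` E)].

(* The library norm on R * R is the max norm, hence this definition. *)
Definition euclidean_ball (R : realType) (x : R * R) (r : R) : set (R * R) :=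
  [set y | Num.sqrt ((y.1 - x.1) ^+ 2 + (y.2 - x.2) ^+ 2) <= r].

(* The infimum is a minimum as soon as a finite cover exists. *)
Definition covering_number (R : realType) (r : R) (A : set (R * R)) : \bar R :=
  ereal_inf [set n%:R%:E | n in
    [set n : nat | exists z : 'I_n -> R * R,
       A `<=` \bigcup_i euclidean_ball (z i) r]].

(* In the two exponent sets, rho is the outer radius and r the covering
   radius. *)
Definition upper_h (R : realType) (E : set (R * R)) (delta : R) : \bar R :=
  ereal_inf [set alpha%:E | alpha in
    [set alpha : R | 0 <= alpha /\
       exists b c : R, [/\ 0 < b, 0 < c &
         forall r rho : R,
           0 < r -> r <= rho `^ (1 + delta) -> rho `^ (1 + delta) <= rho ->
           rho <= b ->
           forall x, E x ->
             (covering_number r (E `&` euclidean_ball x rho)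
                <= (c * (rho / r) `^ alpha)%:E)%E]]].

Definition lower_h (R : realType) (E : set (R * R)) (delta : R) : \bar R :=
  ereal_sup [set alpha%:E | alpha in
    [set alpha : R | 0 <= alpha /\
       exists b c : R, [/\ 0 < b, 0 < c &
         forall r rho : R,
           0 < r -> r <= rho `^ (1 + delta) -> rho `^ (1 + delta) <= rho ->
           rho <= b ->
           forall x, E x ->
             ((c * (rho / r) `^ alpha)%:E
                <= covering_number r (E `&` euclidean_ball x rho))%E]]].

Definition assouad_dim (R : realType) (E : set (R * R)) : \bar R :=
  upper_h E 0.

Definition lower_assouad_dim (R : realType) (E : set (R * R)) : \bar R :=
  lower_h E 0.

(* upper_h E is nonincreasing and lower_h E nondecreasing on [0, 1[, so both
   right limits at 0 exist in \bar R. *)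
Definition quasi_assouad_dim (R : realType) (E : set (R * R)) : \bar R :=
  lim (upper_h E delta @[delta --> (0 : R)^'+]).

Definition quasi_lower_assouad_dim (R : realType) (E : set (R * R)) : \bar R :=
  lim (lower_h E delta @[delta --> (0 : R)^'+]).

(* Main.v *)
Require Import Defs.
From mathcomp Require Import lra ring.

(* Write S_w for the composition of the maps along a word w, with ratios c_w
   and d_w.  When d_w is at most c_w on the relevant words, the part of E in a
   ball of radius R is comparable to approximate squares S_u(E_pi), where
   d_u ~ c_u c_pi ~ R and E_pi consists of the points of E whose code starts
   with the columns of pi.  Applying the inverse of S_u, covering S_u(E_pi) at
   scale t R amounts to covering E_pi by boxes of size c_pi t x t.  As soon as
   the cylinders over a prefix pi1 of pi have height at most t, this covering
   number is, up to a factor, the same for pi1 as for pi; and one may take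
   c_pi1 bounded below by a power of t.  Hence S_u(E_pi) at scale t R may be
   replaced by S_v(E_pi1) at scale t d_v, where v is a power of a letter j with
   d_j < c_j, chosen so that d_v ~ c_v c_pi1; then d_v is bounded below by a
   power of t.  So every pair of scales can be relocated to a pair (r, R) with
   r <= R^(1 + delta) and the same ratio, for every small delta, and both
   exponents are constant for delta in a right neighbourhood of 0.  In the
   Baranski class, squares whose width is reached first are treated by
   exchanging the coordinates. *)

Set Implicit Arguments.
Unset Strict Implicit.
Unset Printing Implicit Defensive.

(** * Coverings by boxes and by Euclidean balls *)

Section BoxCovers.
Context {R : realType}.
Implicit Types (A : set (R * R)) (p q z : R * R) (r s x : R).

Definition box r1 r2 z : set (R * R) :=
  [set p | `|p.1 - z.1| <= r1 /\ `|p.2 - z.2| <= r2].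

(** The two half-sides are independent because inverse branches turn squares into boxes; allowing
    fewer than [n] boxes makes the notion monotone in [n]. *)
Definition box_cover n r1 r2 A :=
  exists2 zs : seq (R * R), (size zs <= n)%N &
    forall p, A p -> exists2 z, z \in zs & box r1 r2 z p.

Lemma box_le r1 r2 s1 s2 z : r1 <= s1 -> r2 <= s2 ->
  box r1 r2 z `<=` box s1 s2 z.
Proof.
by move=> le1 le2 p [h1 h2]; split; [apply: le_trans h1 le1|apply: le_trans h2 le2].
Qed.

(** Changes of coordinates act on covers through this lemma: [phi] moves the centres, and each point
    of [A'] only needs one witness in [A], so [phi] need not map [A] onto [A']. *)
Lemma box_cover_map (phi : R * R -> R * R) n r1 r2 s1 s2 A A' :
  (forall p, A' p -> exists2 q, A q &
     forall z, box r1 r2 z q -> box s1 s2 (phi z) p) ->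
  box_cover n r1 r2 A -> box_cover n s1 s2 A'.
Proof.
move=> H [zs szs cov]; exists [seq phi z | z <- zs]; first by rewrite size_map.
move=> p /H[q /cov[z zin zq] /(_ z zq) ?].
by exists (phi z) => //; apply: map_f.
Qed.

Lemma box_cover_le n n' r1 r2 s1 s2 A A' : (n <= n')%N -> r1 <= s1 ->
  r2 <= s2 -> A' `<=` A -> box_cover n r1 r2 A -> box_cover n' s1 s2 A'.
Proof.
move=> nn' le1 le2 sub [zs szs cov]; exists zs; first exact: leq_trans nn'.
by move=> p /sub/cov[z ? /(box_le le1 le2)]; exists z.
Qed.

Lemma box_coverU n n' r1 r2 A A' : box_cover n r1 r2 A ->
  box_cover n' r1 r2 A' -> box_cover (n + n') r1 r2 (A `|` A').
Proof.
move=> [zs szs cov] [zs' szs' cov']; exists (zs ++ zs').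
  by rewrite size_cat leq_add.
by move=> p [/cov|/cov'] [z zin ?]; exists z => //; rewrite mem_cat zin ?orbT.
Qed.

Lemma box_cover_set0 n r1 r2 : box_cover n r1 r2 set0.
Proof. by exists [::]. Qed.

Lemma box_cover_bigU (T : eqType) (ks : seq T) (F : T -> set (R * R)) n r1 r2 A :
  (forall k, k \in ks -> box_cover n r1 r2 (F k)) ->
  (forall p, A p -> exists2 k, k \in ks & F k p) ->
  box_cover (size ks * n) r1 r2 A.
Proof.
elim: ks A => [|k ks IH] A covF subA.
  by exists [::] => // p /subA[].
rewrite /= mulSn.
have cov2 : box_cover (size ks * n) r1 r2 [set p | exists2 k, k \in ks & F k p].
  by apply: IH => // j jks; apply: covF; rewrite in_cons jks orbT.
apply: box_cover_le (box_coverU (covF k _) cov2) => //; last by rewrite mem_head.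
by move=> p /subA[j]; rewrite in_cons => /orP[/eqP-> ?|? ?]; [left|right; exists j].
Qed.

Definition grid_offset L (i : nat) s : R := (i%:R - L%:R) * s.

Lemma grid_offsetP L s t : 0 < s -> `|t| <= L%:R * s ->
  exists2 i, i \in iota 0 (2 * L).+1 & `|t - grid_offset L i s| <= s.
Proof.
move=> s0 /[!ler_norml]/andP[lo hi].
pose u := t / s + L%:R.
have u0 : 0 <= u by rewrite /u -lerBlDr sub0r ler_pdivlMr //; lra.
have /andP[u1 u2] := Num.Theory.truncn_itv u0.
set i := Num.truncn u in u1 u2.
have tE : t = (u - L%:R) * s by rewrite /u addrK divfK // gt_eqF.
exists i.
  rewrite mem_iota add0n /= ltnS -(ler_nat R); apply: le_trans u1 _.
  by rewrite /u natrM -lerBrDr ler_pdivrMr //; lra.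
rewrite tE /grid_offset -mulrBl opprB addrA subrK normrM (gtr0_norm s0).
rewrite -[leRHS]mul1r ler_pM2r // ger0_norm; rewrite -?natr1 in u2; lra.
Qed.

Definition grid L (s : R * R) z : seq (R * R) :=
  [seq (z.1 + grid_offset L i s.1, z.2 + grid_offset L j s.2) |
     i <- iota 0 (2 * L).+1, j <- iota 0 (2 * L).+1].

Lemma size_grid L (s : R * R) z : size (grid L s z) = ((2 * L).+1 ^ 2)%N.
Proof. by rewrite size_allpairs size_iota mulnn. Qed.

Lemma gridP L s1 s2 z p : 0 < s1 -> 0 < s2 ->
  box (L%:R * s1) (L%:R * s2) z p ->
  exists2 g, g \in grid L (s1, s2) z & box s1 s2 g p.
Proof.
move=> s10 s20 [/(grid_offsetP s10)[i iI bi] /(grid_offsetP s20)[j jI bj]].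
eexists; first by apply: allpairs_f iI jI.
by split; rewrite /= opprD addrA.
Qed.

Lemma box_cover_refine L n s1 s2 A : 0 < s1 -> 0 < s2 ->
  box_cover n (L%:R * s1) (L%:R * s2) A ->
  box_cover ((2 * L).+1 ^ 2 * n) s1 s2 A.
Proof.
move=> s10 s20 [zs szs cov].
have -> : ((2 * L).+1 ^ 2 * n = n * (2 * L).+1 ^ 2)%N by rewrite mulnC.
apply: (@box_cover_le (size zs * (2 * L).+1 ^ 2) _ s1 s2 s1 s2 A) => //.
  by rewrite leq_mul2r szs orbT.
apply: (@box_cover_bigU _ zs (fun z => box (L%:R * s1) (L%:R * s2) z)).
  move=> z _; exists (grid L (s1, s2) z); first by rewrite size_grid.
  by move=> p; apply: gridP.
exact: cov.
Qed.

(* Points of A carry marks (Mk p q: q is a mark of p); the points whose marks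
   share a grid cell are covered together. *)
Lemma box_cover_marks (Mk : R * R -> R * R -> Prop) L n s r1 r2 z A :
  0 < s ->
  (forall p, A p -> exists2 q, Mk p q & box (L%:R * s) (L%:R * s) z q) ->
  (forall g, box_cover n r1 r2 [set p | A p /\ exists2 q, Mk p q & box s s g q]) ->
  box_cover ((2 * L).+1 ^ 2 * n) r1 r2 A.
Proof.
move=> s0 near cov; rewrite -(size_grid L (s, s) z).
apply: (box_cover_bigU (fun g _ => cov g)) => p Ap.
have [q Mq zq] := near p Ap.
have [g gin gq] := gridP s0 s0 zq.
by exists g => //; split=> //; exists q.
Qed.

Lemma euclidean_ball_box z r : euclidean_ball z r `<=` box r r z.
Proof.
move=> p; rewrite /euclidean_ball /= => h; split.
  apply: le_trans h; rewrite -sqrtr_sqr; apply: ler_wsqrtr.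
  by rewrite lerDl sqr_ge0.
apply: le_trans h; rewrite -sqrtr_sqr; apply: ler_wsqrtr.
by rewrite lerDr sqr_ge0.
Qed.

(** The factor 2 replaces the sharp square root of 2; only constants are affected. *)
Lemma box_euclidean_ball r z : 0 <= r -> box r r z `<=` euclidean_ball z (2 * r).
Proof.
move=> r0 p [h1 h2]; rewrite /euclidean_ball /=.
have r20 : 0 <= 2 * r by rewrite mulr_ge0.
rewrite -[leRHS]ger0_norm // -sqrtr_sqr; apply: ler_wsqrtr.
have k1 : (p.1 - z.1) ^+ 2 <= r ^+ 2.
  by rewrite -[leLHS]real_normK ?num_real // ler_sqr ?nnegrE.
have k2 : (p.2 - z.2) ^+ 2 <= r ^+ 2.
  by rewrite -[leLHS]real_normK ?num_real // ler_sqr ?nnegrE.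
by rewrite exprMn; have := sqr_ge0 r; lra.
Qed.

Lemma covering_number_le n r A : 0 < r -> box_cover n (r / 2) (r / 2) A ->
  (covering_number r A <= n%:R%:E)%E.
Proof.
move=> r0 [zs szs cov]; apply: (@le_trans _ _ (size zs)%:R%:E); last first.
  by rewrite lee_fin ler_nat.
apply: ereal_inf_lbound; exists (size zs) => //=.
exists (tnth (in_tuple zs)) => p /cov[z /seq_tnthP[i ->] zp]; exists i => //.
have -> : r = 2 * (r / 2) by rewrite mulrCA divff ?mulr1.
by apply: box_euclidean_ball => //; rewrite divr_ge0 // ltW.
Qed.

(** The strict bound yields an actual cover although [covering_number] is an infimum. *)
Lemma covering_number_lt (y : R) r A : (covering_number r A < y%:E)%E ->
  exists2 n, n%:R < y & box_cover n r r A.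
Proof.
move=> /ereal_inf_lt[_ [n [z cov] <-]]; rewrite lte_fin => ny; exists n => //.
exists [seq z i | i <- enum 'I_n]; first by rewrite size_map size_enum_ord.
move=> p /cov[i _ /(@euclidean_ball_box _ _ _) ?].
by exists (z i) => //; apply/map_f; rewrite mem_enum.
Qed.

Lemma le_covering_number (y : R) r A :
  (forall n, box_cover n r r A -> y <= n%:R) -> (y%:E <= covering_number r A)%E.
Proof.
move=> H; apply: le_ereal_inf_tmp => _ [n [z cov] <-]; rewrite lee_fin; apply: H.
exists [seq z i | i <- enum 'I_n]; first by rewrite size_map size_enum_ord.
move=> p /cov[i _ /(@euclidean_ball_box _ _ _) ?].
by exists (z i) => //; apply/map_f; rewrite mem_enum.
Qed.

Definition transpose A : set (R * R) := [set p | A (p.2, p.1)].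

Lemma box_cover_transpose n r1 r2 A :
  box_cover n r1 r2 (transpose A) -> box_cover n r2 r1 A.
Proof.
apply: (@box_cover_map (fun z => (z.2, z.1))) => -[p1 p2] Ap.
by exists (p2, p1) => // z [? ?]; split.
Qed.

Lemma euclidean_ball_transpose z r :
  transpose (euclidean_ball (z.2, z.1) r) = euclidean_ball z r.
Proof. by apply/seteqP; split=> p /=; rewrite /transpose/euclidean_ball/= addrC. Qed.

Lemma covering_number_transpose r A :
  covering_number r (transpose A) = covering_number r A.
Proof.
rewrite /covering_number; congr ereal_inf; congr image.
apply/seteqP; split=> n /= [z cov]; exists (fun i => ((z i).2, (z i).1)).
  move=> p Ap; have [|i _] := cov (p.2, p.1); first by case: p Ap.
  by rewrite -euclidean_ball_transpose /transpose /=; exists i => //; case: p Ap b.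
move=> p Ap; have [|i _] := cov (p.2, p.1); first by [].
by rewrite -euclidean_ball_transpose /transpose /=; exists i => //; case: p Ap b.
Qed.

End BoxCovers.

(** * Words of affine maps of the line and stopping words *)

Section AffineWords.
Context {R : realType} {I : eqType} (s t : I -> R).
Implicit Types (u v w : seq I) (x y z : R).

Definition affw w x := foldr (fun i y => s i * y + t i) x w.

Definition ratw w := \prod_(i <- w) s i.

Lemma affw_cat u v x : affw (u ++ v) x = affw u (affw v x).
Proof. by rewrite /affw foldr_cat. Qed.

Lemma ratw_cat u v : ratw (u ++ v) = ratw u * ratw v.
Proof. by rewrite /ratw big_cat. Qed.

Lemma ratw_nil : ratw [::] = 1.
Proof. by rewrite /ratw big_nil. Qed.

Lemma ratw_cons i w : ratw (i :: w) = s i * ratw w.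
Proof. by rewrite /ratw big_cons. Qed.

Lemma ratw_nseq n i : ratw (nseq n i) = s i ^+ n.
Proof.
by elim: n => [|n IH]; rewrite ?ratw_nil ?expr0 //= ratw_cons IH exprS.
Qed.

Lemma affwB w x y : affw w x - affw w y = ratw w * (x - y).
Proof.
elim: w => [|i w IH] /=; first by rewrite ratw_nil mul1r.
by rewrite ratw_cons -mulrA -IH; ring.
Qed.

Definition affw_inv w z := (z - affw w 0) / ratw w.

(** Letters may differ as long as their maps agree: this identifies words running through the same
    columns. *)
Lemma affw_same w w' : [seq (s i, t i) | i <- w] = [seq (s i, t i) | i <- w'] ->
  affw w =1 affw w' /\ ratw w = ratw w'.
Proof.
elim: w w' => [|i w IH] [|i' w'] //=.
case=> es et /IH[ea er]; rewrite !ratw_cons es er; split=> // x.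
by rewrite /= es et ea.
Qed.

Hypothesis (s_gt0 : forall i, 0 < s i).

Lemma ratw_gt0 w : 0 < ratw w.
Proof. by rewrite /ratw prodr_gt0. Qed.

Lemma affw_invK w : cancel (affw_inv w) (affw w).
Proof.
move=> z; have := affwB w (affw_inv w z) 0.
rewrite subr0 /affw_inv mulrCA divff ?gt_eqF ?ratw_gt0 // mulr1.
exact: addIr.
Qed.

Lemma dist_affw w x z : `|affw w x - affw w z| = ratw w * `|x - z|.
Proof. by rewrite affwB normrM gtr0_norm ?ratw_gt0. Qed.

Lemma ler_affw w x y : (affw w x <= affw w y) = (x <= y).
Proof. by rewrite -subr_ge0 affwB pmulr_rge0 ?ratw_gt0 // subr_ge0. Qed.

Lemma affw_itv x0 x1 (H : forall i, x0 <= s i * x0 + t i /\ s i * x1 + t i <= x1)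
  w x : x0 <= x <= x1 -> x0 <= affw w x <= x1.
Proof.
move=> xin; elim: w => //= i w /andP[h0 h1]; have [k0 k1] := H i.
by apply/andP; split; [apply: le_trans k0 _|apply: le_trans _ k1];
   rewrite lerD2r ler_pM2l.
Qed.

Lemma ratw_le_pow mu w : (forall i, s i <= mu) -> ratw w <= mu ^+ size w.
Proof.
move=> H; elim: w => [|i w IH]; first by rewrite ratw_nil.
by rewrite ratw_cons exprS ler_pM // ltW // ratw_gt0.
Qed.

Lemma pow_le_ratw lam w : 0 <= lam -> (forall i, lam <= s i) ->
  lam ^+ size w <= ratw w.
Proof.
move=> l0 H; elim: w => [|i w IH]; first by rewrite ratw_nil.
by rewrite ratw_cons exprS ler_pM // exprn_ge0.
Qed.

Hypothesis (s_lt1 : forall i, s i < 1).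

Lemma ratw_le1 w : ratw w <= 1.
Proof.
have := @ratw_le_pow 1 w (fun i => ltW (s_lt1 i)).
by rewrite expr1n.
Qed.

(** The word is cut at the first moment when its ratio drops to [r]; such words form an antichain
    for the prefix order. *)
Definition stops r w := ratw w <= r /\
  forall k, (k < size w)%N -> r < ratw (take k w).

(** Without its last letter the word still has ratio above [r], and one letter costs a factor no
    smaller than [lam]; [r < 1] excludes the empty word. *)
Lemma stops_gt lam r w : 0 < lam -> (forall i, lam <= s i) -> 0 < r -> r < 1 ->
  stops r w -> lam * r < ratw w.
Proof.
move=> l0 ls r0 r1 []; case/lastP: w => [|w i]; first by rewrite ratw_nil; lra.
move=> _ /(_ (size w)); rewrite size_rcons ltnSn => /(_ isT).
rewrite -cats1 take_size_cat // ratw_cat ratw_cons ratw_nil mulr1 => h.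
rewrite mulrC; apply: (@lt_le_trans _ _ (ratw w * lam)); first by rewrite ltr_pM2r.
by rewrite ler_pM2l // ratw_gt0.
Qed.

Lemma exists_stops r w : ratw w <= r ->
  exists2 k, (k <= size w)%N & stops r (take k w).
Proof.
move=> wr; have ex : exists k, ratw (take k w) <= r.
  by exists (size w); rewrite take_size.
case: (ex_minnP ex) => k kr kmin.
have kw : (k <= size w)%N by apply: kmin; rewrite take_size.
exists k => //; split=> // j; rewrite size_takel // => jk.
by rewrite take_takel ?(ltnW jk) // ltNge; apply/negP => /kmin; rewrite leqNgt jk.
Qed.

Lemma stops_size_le r w w' : stops r w -> stops r w' ->
  ratw (take (size w) w') = ratw w -> (size w' <= size w)%N.
Proof.
move=> [wr _] [_ st'] e; rewrite leqNgt; apply/negP => /st'.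
by rewrite e ltNge wr.
Qed.

End AffineWords.

(** * Separated intervals of words *)

Section Separation.
Context {R : realType} {I : eqType} (s t : I -> R) (x0 x1 : R).
Hypothesis s_gt0 : forall i, 0 < s i.
Hypothesis itv01 : x0 <= x1.
Hypothesis stable : forall i, x0 <= s i * x0 + t i /\ s i * x1 + t i <= x1.
Implicit Types (u v w : seq I).

(** Disjointness of the images of the open interval; weak inequalities let the closed images share
    an endpoint, as adjacent rectangles do. *)
Definition apart u v :=
  affw s t u x1 <= affw s t v x0 \/ affw s t v x1 <= affw s t u x0.

Lemma apart_cat u v w w' : apart u v -> apart (u ++ w) (v ++ w').
Proof.
rewrite /apart !affw_cat.
have hw v' : x0 <= affw s t v' x0 /\ affw s t v' x1 <= x1.
  have := @affw_itv _ _ _ _ s_gt0 _ _ stable v' x0.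
  have := @affw_itv _ _ _ _ s_gt0 _ _ stable v' x1.
  by rewrite !lexx itv01 /= => /(_ isT)/andP[_ ->] /(_ isT)/andP[->].
have [a1 a2] := hw w; have [b1 b2] := hw w'.
move=> [h|h]; [left|right]; (apply: le_trans; [|apply: le_trans; [exact: h|]]);
  by rewrite ler_affw.
Qed.

Lemma apart_catl u v w : apart v w -> apart (u ++ v) (u ++ w).
Proof.
by rewrite /apart !affw_cat => -[h|h]; [left|right]; rewrite ler_affw.
Qed.

(** In its interval the image of [z] keeps a margin of [eta] times the ratio from both ends, and two
    such margins lie between the two images. *)
Lemma apart_dist eta rho z u v : 0 < eta -> x0 + eta <= z -> z <= x1 - eta ->
  rho < ratw s u -> rho < ratw s v ->
  apart u v -> 2 * (eta * rho) < `|affw s t u z - affw s t v z|.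
Proof.
move=> e0 z0 z1 ru rv.
wlog: u v ru rv / affw s t u x1 <= affw s t v x0 => [W|le _].
  by move=> [h|h]; [|rewrite distrC]; apply: W => //; left.
have eqv : affw s t v z - affw s t u z = (affw s t v z - affw s t v x0) +
   (affw s t u x1 - affw s t u z) + (affw s t v x0 - affw s t u x1) by ring.
rewrite distrC; apply: lt_le_trans (ler_norm _); rewrite eqv !affwB.
have k1 : eta * rho < ratw s v * (z - x0).
  apply: (@lt_le_trans _ _ (eta * ratw s v)); first by rewrite ltr_pM2l.
  by rewrite mulrC ler_pM2l ?ratw_gt0 //; lra.
have k2 : eta * rho < ratw s u * (x1 - z).
  apply: (@lt_le_trans _ _ (eta * ratw s u)); first by rewrite ltr_pM2l.
  by rewrite mulrC ler_pM2l ?ratw_gt0 //; lra.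
by lra.
Qed.

End Separation.

(** * Powers and scales *)

Section Powers.
Context {R : realType}.

Lemma exists_expr_le (x e : R) : 0 < x < 1 -> 0 < e -> exists n, x ^+ n <= e.
Proof.
move=> /andP[x0 x1] e0.
have : (fun n => x ^+ n) @ \oo --> (0 : R) by apply: cvg_expr; rewrite gtr0_norm.
move=> /cvgrPdist_le/(_ e e0)[N _ /(_ N (leqnn _))].
by rewrite sub0r normrN gtr0_norm ?exprn_gt0 // => h; exists N.
Qed.

Lemma exists_expr_scale (x e : R) : 0 < x < 1 -> 0 < e <= 1 ->
  exists n, x ^+ n <= e /\ e * x <= x ^+ n.
Proof.
move=> /[dup] xb /andP[x0 x1] /andP[e0 e1].
have ex := exists_expr_le xb e0.
case: (ex_minnP ex) => -[|n] ne nmin.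
  by exists 0%N; rewrite expr0 in ne *; split=> //; nra.
exists n.+1; split=> //; rewrite exprS mulrC ler_pM2l // leNgt; apply/negP => /ltW/nmin.
by rewrite ltnn.
Qed.

(** As [delta * K] and [x] are at most 1, [x] is at most its power of exponent [K * delta], hence at
    most [y] to the power [delta]. This turns a polynomial bound between scales into the constraint
    of the quasi dimensions. *)
Lemma le_powR_of_expr (x y delta : R) K : 0 < x <= 1 -> x ^+ K <= y -> 0 < y ->
  0 <= delta -> delta * K%:R <= 1 -> x <= y `^ delta.
Proof.
move=> /andP[x0 x1] xy y0 d0 dK.
apply: (@le_trans _ _ ((x ^+ K) `^ delta)); last first.
  by apply: ge0_ler_powR => //; rewrite nnegrE ltW // exprn_gt0.
have x0' := ltW x0; rewrite -powR_mulrn // -powRrM -[leLHS]powRr1 //.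
by apply: ger_powR; rewrite ?x0 // mulrC.
Qed.

End Powers.

(* The open box ]x0, x1[ x ]y0, y1[ is a strong open set condition for E (zeta
   is a point of E in it); it need not be the open unit square, which misses E
   when E lies on one of its sides. *)
Record column_carpet (R : realType) (I : finType) (c d a b : I -> R)
    (E : set (R * R)) (lam mu x0 x1 y0 y1 eta : R) (zeta : R * R)
    (core : seq I) : Prop :=
  ColumnCarpet {
    carpet_lam : 0 < lam;
    carpet_mu : 0 < mu < 1;
    carpet_c : forall i, lam <= c i <= mu;
    carpet_d : forall i, lam <= d i <= mu;
    carpet_x : forall i, x0 <= c i * x0 + a i /\ c i * x1 + a i <= x1;
    carpet_y : forall i, y0 <= d i * y0 + b i /\ d i * y1 + b i <= y1;
    carpet_sep : forall i j, i != j ->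
      ((c i, a i) = (c j, a j) /\ apart d b y0 y1 [:: i] [:: j]) \/
      apart c a x0 x1 [:: i] [:: j];
    carpet_unit : E `<=` @unit_square R;
    carpet_box : forall p, E p -> x0 <= p.1 <= x1 /\ y0 <= p.2 <= y1;
    carpet_inv : forall p, E p <->
      exists i e, E e /\ p = (c i * e.1 + a i, d i * e.2 + b i);
    carpet_zeta : E zeta;
    carpet_eta : 0 < eta <= 1;
    carpet_zeta1 : x0 + eta <= zeta.1 <= x1 - eta;
    carpet_zeta2 : y0 + eta <= zeta.2 <= y1 - eta;
    carpet_core : forall p, E p -> y0 + eta <= affw d b core p.2 <= y1 - eta;
    carpet_wide : exists i, d i < c i
  }.

(** * Approximate squares of a carpet *)

Section Cells.
Context {R : realType} {I : finType} (c d a b : I -> R) (E : set (R * R)).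
Implicit Types (u v w pi : seq I) (p q e z : R * R) (r rho : R).

Definition Sw w e : R * R := (affw c a w e.1, affw d b w e.2).

Definition col w := [seq (c i, a i) | i <- w].

(* For ratw d u ~ ratw c (u ++ pi) this is an approximate square: the points
   of E whose code starts with u and continues through the columns of pi. *)
Definition colcell u pi : set (R * R) :=
  [set p | exists w e, [/\ col w = col pi, E e & p = Sw (u ++ w) e]].

(** Both sides of the approximate square are of order [r], and the height reaches [r] no later than
    the width, at the end of [u]. *)
Definition vcell r u pi := stops d r u /\ stops c r (u ++ pi).

Lemma Sw_cat u w e : Sw (u ++ w) e = Sw u (Sw w e).
Proof. by rewrite /Sw !affw_cat. Qed.

Lemma affw_col w w' x : col w = col w' -> affw c a w x = affw c a w' x.
Proof. by move=> /affw_same[]. Qed.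

Lemma ratw_col w w' : col w = col w' -> ratw c w = ratw c w'.
Proof. by move=> /affw_same[]. Qed.

Lemma eq_cell u pi pi' : col pi = col pi' -> colcell u pi = colcell u pi'.
Proof. by rewrite /colcell => ->. Qed.

Variables (lam mu x0 x1 y0 y1 eta : R) (zeta : R * R) (core : seq I).
Hypothesis H : column_carpet c d a b E lam mu x0 x1 y0 y1 eta zeta core.

Let lam0 := carpet_lam H.

Lemma carpet_c_gt0 i : 0 < c i.
Proof. by have /andP[+ _] := carpet_c H i; apply: lt_le_trans. Qed.

Lemma carpet_d_gt0 i : 0 < d i.
Proof. by have /andP[+ _] := carpet_d H i; apply: lt_le_trans. Qed.

Lemma carpet_c_lt1 i : c i < 1.
Proof.
have /andP[_ h] := carpet_c H i; apply: le_lt_trans h _.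
by have /andP[] := carpet_mu H.
Qed.

Lemma carpet_d_lt1 i : d i < 1.
Proof.
have /andP[_ h] := carpet_d H i; apply: le_lt_trans h _.
by have /andP[] := carpet_mu H.
Qed.

Let c0 := carpet_c_gt0.
Let d0 := carpet_d_gt0.

Lemma carpet_unit1 p : E p -> [/\ 0 <= p.1, p.1 <= 1, 0 <= p.2 & p.2 <= 1].
Proof. by move=> /(carpet_unit H)[]; rewrite /= !in_itv /= => /andP[? ?] /andP[]. Qed.

Lemma dist_carpet p q : E p -> E q -> `|p.1 - q.1| <= 1 /\ `|p.2 - q.2| <= 1.
Proof.
move=> /carpet_unit1[? ? ? ?] /carpet_unit1[? ? ? ?].
by rewrite !ler_norml; split; lra.
Qed.

Lemma Sw_carpet w e : E e -> E (Sw w e).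
Proof.
by move=> Ee; elim: w => [|i w IH]; [case: e Ee|apply/(carpet_inv H); exists i, (Sw w e)].
Qed.

Lemma carpet_code p n : E p -> exists w e, [/\ size w = n, E e & p = Sw w e].
Proof.
elim: n p => [|n IH] p Ep; first by exists [::], p; case: p Ep.
have [i [q [/IH[w [e [sw Ee ->]] ->]]]] := (carpet_inv H p).1 Ep.
by exists (i :: w), e; rewrite /= sw.
Qed.

Lemma cell_sub u pi : colcell u pi `<=` E.
Proof. by move=> _ [w [e [_ Ee ->]]]; apply: Sw_carpet. Qed.

(** [Sw u] carries the cell over the empty word onto the cell over [u] and scales boxes by its two
    ratios; [cell_pull] is the inverse operation. *)
Lemma cell_push n r1 r2 u pi : box_cover n r1 r2 (colcell [::] pi) ->
  box_cover n (ratw c u * r1) (ratw d u * r2) (colcell u pi).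
Proof.
apply: (@box_cover_map _ (Sw u)) => _ [w [e [cw Ee ->]]].
exists (Sw w e); first by exists w, e.
move=> z [h1 h2]; split; rewrite Sw_cat /=.
  by rewrite dist_affw // ler_pM2l ?ratw_gt0.
by rewrite dist_affw // ler_pM2l ?ratw_gt0.
Qed.

Lemma cell_pull n r1 r2 u pi : box_cover n r1 r2 (colcell u pi) ->
  box_cover n (r1 / ratw c u) (r2 / ratw d u) (colcell [::] pi).
Proof.
apply: (@box_cover_map _ (fun z => (affw_inv c a u z.1, affw_inv d b u z.2))).
move=> _ [w [e [cw Ee ->]]]; exists (Sw (u ++ w) e); first by exists w, e.
move=> z []; rewrite Sw_cat /= -{1}(affw_invK a c0 u z.1).
rewrite -{1}(affw_invK b d0 u z.2) !dist_affw // => h1 h2.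
by split; rewrite ler_pdivlMr ?ratw_gt0 // mulrC.
Qed.

Lemma dist_Sw2 n rho y w w' e : size y = n -> mu ^+ n <= rho -> E e ->
  `|(Sw (y ++ w) e).2 - (Sw (y ++ w') e).2| <= rho.
Proof.
move=> sy le Ee; rewrite !Sw_cat /= dist_affw //; apply: le_trans le.
rewrite -[leRHS]mulr1; apply: ler_pM; [exact/ltW/ratw_gt0|by []|..].
  by rewrite -sy; apply: ratw_le_pow => // i; have /andP[] := carpet_d H i.
by have [] := dist_carpet (Sw_carpet w Ee) (Sw_carpet w' Ee).
Qed.

(* Inside a cylinder of height at most rho only the x-coordinate matters at
   scale rho, and there the extra columns pi' act by the similarity affw c a:
   hence the two coverings below differ by a bounded factor only. *)
Lemma cell_shorten n rho pi pi' : 0 <= rho -> pi' = [::] \/ mu ^+ size pi <= rho ->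
  box_cover n (ratw c (pi ++ pi') * rho) rho (colcell [::] (pi ++ pi')) ->
  box_cover n (ratw c pi * rho) (2 * rho) (colcell [::] pi).
Proof.
move=> rho0 [->|le].
  by rewrite cats0; apply: box_cover_le => //; lra.
apply: (@box_cover_map _ (fun z => (affw c a pi (affw_inv c a (pi ++ pi') z.1), z.2))).
move=> _ [y [e [cy Ee ->]]].
have sy : size y = size pi by rewrite -(size_map (fun i => (c i, a i)) y) -/(col y) cy size_map.
exists (Sw (y ++ pi') e).
  by exists (y ++ pi'), e; split=> //; rewrite /col !map_cat -!/(col _) cy.
move=> z [h1 h2]; split=> /=.
  have cE : col (y ++ pi') = col (pi ++ pi') by rewrite /col !map_cat -!/(col _) cy.
  move: h1; rewrite -{1}(affw_invK a c0 (pi ++ pi') z.1) /= (affw_col _ cE).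
  by rewrite dist_affw // ler_pM2l ?ratw_gt0 // (affw_col _ cy) dist_affw // ler_pM2l ?ratw_gt0.
have -> : (affw d b y e.2 - z.2 =
   ((Sw (y ++ [::]) e).2 - (Sw (y ++ pi') e).2) + (affw d b (y ++ pi') e.2 - z.2)).
  by rewrite cats0 /=; ring.
apply: le_trans (ler_normD _ _) _; rewrite mulrDl !mul1r lerD //.
exact: dist_Sw2 le Ee.
Qed.

Lemma cell_lengthen n rho pi pi' : 0 <= rho -> pi' = [::] \/ mu ^+ size pi <= rho ->
  box_cover n (ratw c pi * rho) rho (colcell [::] pi) ->
  box_cover n (ratw c (pi ++ pi') * rho) (2 * rho) (colcell [::] (pi ++ pi')).
Proof.
move=> rho0 [->|le].
  by rewrite cats0; apply: box_cover_le => //; lra.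
apply: (@box_cover_map _ (fun z => (affw c a (pi ++ pi') (affw_inv c a pi z.1), z.2))).
move=> _ [w [e [cw Ee ->]]].
pose y := take (size pi) w; pose w' := drop (size pi) w.
have wE : w = y ++ w' by rewrite cat_take_drop.
have cy : col y = col pi.
  by rewrite /y /col map_take -/(col w) cw /col map_cat take_size_cat // size_map.
have sy : size y = size pi by rewrite -(size_map (fun i => (c i, a i)) y) -/(col y) cy size_map.
exists (Sw y e); first by exists y, e.
move=> z [h1 h2]; split=> /=.
  move: h1; rewrite -{1}(affw_invK a c0 pi z.1) /= (affw_col _ cy).
  by rewrite dist_affw // ler_pM2l ?ratw_gt0 // (affw_col _ cw) dist_affw // ler_pM2l ?ratw_gt0.
have -> : (affw d b w e.2 - z.2 =
   ((Sw (y ++ w') e).2 - (Sw (y ++ [::]) e).2) + (affw d b y e.2 - z.2)).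
  by rewrite cats0 /= -wE; ring.
apply: le_trans (ler_normD _ _) _; rewrite mulrDl !mul1r lerD //.
exact: dist_Sw2 le Ee.
Qed.

(** At most [#|I| ^ size w0] words run through the columns of [w0], and each contributes an affine
    copy of the cell of [pi], whose height only shrinks. *)
Lemma cell_prefix n r1 r2 w0 pi : 0 <= r2 -> box_cover n r1 r2 (colcell [::] pi) ->
  box_cover (#|I| ^ size w0 * n) (ratw c w0 * r1) r2 (colcell [::] (w0 ++ pi)).
Proof.
move=> r20 cov; rewrite -card_tuple cardE.
pose F (t : (size w0).-tuple I) :=
  if col t == col w0 then colcell t pi else set0.
apply: (@box_cover_bigU _ _ _ F) => [t _|_ [w [e [cw Ee ->]]]].
  rewrite /F; case: eqP => [ct|_]; last exact: box_cover_set0.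
  apply: box_cover_le (cell_push t cov) => //; first by rewrite (ratw_col ct).
  by rewrite ler_piMl // ratw_le1 // => i; apply: carpet_d_lt1.
pose y := take (size w0) w; pose w' := drop (size w0) w.
have wE : w = y ++ w' by rewrite cat_take_drop.
have cy : col y = col w0.
  by rewrite /y /col map_take -/(col w) cw /col map_cat take_size_cat // size_map.
have sy : size y == size w0.
  by rewrite -(size_map (fun i => (c i, a i)) y) -/(col y) cy size_map.
exists (Tuple sy); first by rewrite mem_enum.
rewrite /F /= cy eqxx; exists w', e; rewrite /= wE; split=> //.
by move: cw; rewrite /w' /col map_drop -/(col w) => ->; rewrite map_cat drop_size_cat // size_map.
Qed.

Let x01 : x0 <= x1.
Proof. by have /andP[e0 _] := carpet_eta H; have /andP[] := carpet_zeta1 H; lra. Qed.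

Let y01 : y0 <= y1.
Proof. by have /andP[e0 _] := carpet_eta H; have /andP[] := carpet_zeta2 H; lra. Qed.

Lemma not_apart_open (s t : I -> R) (z0 z1 e : R) i j w : (forall i, 0 < s i) ->
  (forall i, z0 <= s i * z0 + t i /\ s i * z1 + t i <= z1) ->
  z0 <= e <= z1 ->
  affw s t (i :: w) z0 < s j * e + t j < affw s t (i :: w) z1 ->
  ~ apart s t z0 z1 [:: i] [:: j].
Proof.
move=> s0 st /andP[e0 e1] /= /andP[h0 h1].
have z01 : z0 <= z1 := le_trans e0 e1.
have [+ +] : (z0 <= affw s t w z0 <= z1 /\ z0 <= affw s t w z1 <= z1).
  by split; apply: affw_itv => //; rewrite lexx ?z01.
move=> /andP[k0 _] /andP[_ k1].
have a0 : s j * z0 <= s j * e by rewrite ler_pM2l.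
have a1 : s j * e <= s j * z1 by rewrite ler_pM2l.
have b0 : s i * z0 <= s i * affw s t w z0 by rewrite ler_pM2l.
have b1 : s i * affw s t w z1 <= s i * z1 by rewrite ler_pM2l.
by case=> /=; lra.
Qed.

(** A point strictly inside the column strip of [pi] has no code starting in another column, since
    distinct columns are apart; induction reads off [pi] column by column. *)
Lemma mem_cell_columns pi p : E p ->
  affw c a pi x0 < p.1 < affw c a pi x1 -> colcell [::] pi p.
Proof.
elim: pi p => [|i pi IH] p Ep hp; first by exists [::], p; split=> //; case: p {hp} Ep.
have [j [e [Ee pE]]] := (carpet_inv H p).1 Ep.
suff cE : (c j, a j) = (c i, a i).
  case: cE => cE aE; move: hp; rewrite pE /= cE aE !ltrD2r !ltr_pM2l // => he.
  have [w [e' [cw Ee' eE]]] := IH e Ee he.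
  exists (j :: w), e'; split=> //; first by rewrite /col /= -!/(col _) cw cE aE.
  by rewrite eE /= /Sw /= cE aE.
have [-> //|] := eqVneq i j.
move=> /(carpet_sep H)[[-> _] //|].
rewrite pE in hp; move=> ap; exfalso.
by apply: not_apart_open (carpet_x H) _ hp ap => //; have [] := carpet_box H Ee.
Qed.

(** Strictly inside the rectangle, both coordinates together determine the letters of [v]. So a ball
    well inside an approximate square meets [E] in that cell only, which is the source of the lower
    bounds. *)
Lemma mem_cell_open v pi p : E p ->
  affw c a (v ++ pi) x0 < p.1 < affw c a (v ++ pi) x1 ->
  affw d b v y0 < p.2 < affw d b v y1 -> colcell v pi p.
Proof.
elim: v p => [|i v IH] p Ep hp hp2; first exact: mem_cell_columns.
have [j [e [Ee pE]]] := (carpet_inv H p).1 Ep.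
have [e1 e2] := carpet_box H Ee.
suff ji : j = i.
  move: hp hp2; rewrite pE ji /= !ltrD2r !ltr_pM2l // => he he2.
  have [w [e' [cw Ee' eE]]] := IH e Ee he he2.
  by exists w, e'; split=> //; rewrite eE.
apply/eqP; rewrite eq_sym; apply: contraT => /(carpet_sep H) ij; exfalso.
rewrite pE in hp hp2; case: ij => [[_]|].
  exact: not_apart_open (carpet_y H) e2 hp2.
exact: not_apart_open (carpet_x H) e1 hp.
Qed.

(** The first differing letters decide, through [carpet_sep]; common prefixes preserve
    separation. *)
Lemma word_sep u v : prefix u v \/ prefix v u \/
  apart c a x0 x1 u v \/ apart d b y0 y1 u v.
Proof.
elim: u v => [|i u IH] [|j v]; [by left|by left; rewrite prefix0s|by right; left|].
have [->|ij] := eqVneq i j.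
  rewrite !prefix_cons eqxx /=; have [|[|[|]]] := IH v; [by left|by right; left|..].
    by move=> /(apart_catl c0 [:: j]) ?; right; right; left.
  by move=> /(apart_catl d0 [:: j]) ?; right; right; right.
right; right; have [[_]|] := carpet_sep H ij.
  by move=> /(apart_cat d0 y01 (carpet_y H) u v) ?; right.
by move=> /(apart_cat c0 x01 (carpet_x H) u v) ?; left.
Qed.

Lemma col_sep u v : col u = take (size u) (col v) \/
  col v = take (size v) (col u) \/ apart c a x0 x1 u v.
Proof.
elim: u v => [|i u IH] [|j v]; [by left|by left; rewrite take0|by right; left; rewrite take0|].
have [[ce ae]|ne] := pselect ((c i, a i) = (c j, a j)).
  rewrite /= ce ae; have [|[|]] := IH v; [by move=> <-; left|by move=> <-; right; left|].
  by right; right; rewrite /apart /= ce ae !lerD2r !ler_pM2l.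
have [ij|ij] := eqVneq i j; first by rewrite ij in ne.
have [[]|] := carpet_sep H ij; first by [].
by move=> /(apart_cat c0 x01 (carpet_x H) u v) ?; right; right.
Qed.

(** The image of [zeta] in the rectangle around the approximate square; it need not lie in [E], as
    its height is taken from [u] alone. *)
Definition mark u pi := (affw c a (u ++ pi) zeta.1, affw d b u zeta.2).

Lemma stops_prefix (s : I -> R) r u v : stops s r u -> stops s r v ->
  prefix u v -> u = v.
Proof.
move=> su sv /prefixP[w vE].
have : (size v <= size u)%N.
  by apply: stops_size_le su sv _; rewrite vE take_size_cat.
rewrite vE size_cat; case: w vE => [|i w] _; first by rewrite cats0.
by rewrite /= addnS ltnNge leq_addr.
Qed.

Lemma stops_col r u v v' : stops c r (u ++ v) -> stops c r (u ++ v') ->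
  col v = take (size v) (col v') -> col v = col v'.
Proof.
move=> s1 s2; rewrite /col -map_take -!/(col _) => e.
have : (size (u ++ v') <= size (u ++ v))%N.
  apply: stops_size_le s1 s2 _; rewrite size_cat takeD take_size_cat // drop_size_cat //.
  by rewrite !ratw_cat (ratw_col e).
by rewrite !size_cat leq_add2l e => /take_oversize->.
Qed.

(** Words separated in one coordinate have marks more than [2 * (eta * (lam * r))] apart in it.
    Marks in a common box thus rule out separation, and stopping words that are not separated
    coincide up to columns. *)
Lemma vcell_unique r g u pi u' pi' : 0 < r -> r < 1 ->
  vcell r u pi -> vcell r u' pi' ->
  box (eta * (lam * r)) (eta * (lam * r)) g (mark u pi) ->
  box (eta * (lam * r)) (eta * (lam * r)) g (mark u' pi') ->
  colcell u pi = colcell u' pi'.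
Proof.
move=> r0 r1 [su sc] [su' sc'] [g1 g2] [g1' g2'].
have /andP[eta0 _] := carpet_eta H.
have lc : forall i, lam <= c i by move=> i; have /andP[] := carpet_c H i.
have ld : forall i, lam <= d i by move=> i; have /andP[] := carpet_d H i.
have dist3 (x y z e : R) : `|x - z| <= e -> `|y - z| <= e -> `|x - y| <= 2 * e.
  by rewrite !ler_norml => /andP[? ?] /andP[? ?]; lra.
have nx : ~ apart c a x0 x1 (u ++ pi) (u' ++ pi').
  have /andP[z0 z1] := carpet_zeta1 H.
  move=> /(apart_dist c0 eta0 z0 z1 (stops_gt c0 lam0 lc r0 r1 sc) (stops_gt c0 lam0 lc r0 r1 sc')).
  by rewrite ltNge => /negP; apply; apply: dist3 g1 g1'.
have ny : ~ apart d b y0 y1 u u'.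
  have /andP[z0 z1] := carpet_zeta2 H.
  move=> /(apart_dist d0 eta0 z0 z1 (stops_gt d0 lam0 ld r0 r1 su) (stops_gt d0 lam0 ld r0 r1 su')).
  by rewrite ltNge => /negP; apply; apply: dist3 g2 g2'.
have uE : u = u'.
  have [/(stops_prefix su su') //|[/(stops_prefix su' su) //|[|//]]] := word_sep u u'.
  by move=> /(apart_cat c0 x01 (carpet_x H) pi pi').
rewrite uE in sc nx *; apply: eq_cell.
have [/(stops_col sc sc') //|[/(stops_col sc' sc) //|]] := col_sep pi pi'.
by move=> /(apart_catl c0 u').
Qed.

End Cells.

(** * Relocation of pairs of scales *)

Section Relocation.
Context {R : realType} {I : finType} (c d a b : I -> R) (E : set (R * R)).
Context (lam mu x0 x1 y0 y1 eta : R) (zeta : R * R) (core : seq I).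
Hypothesis H : column_carpet c d a b E lam mu x0 x1 y0 y1 eta zeta core.

Local Notation colcell := (colcell c d a b E).
Let c0 := carpet_c_gt0 H.
Let d0 := carpet_d_gt0 H.

(** [K] depends on the carpet only, so one range of [delta] serves all exponents. [beta] keeps the
    new outer scale below a prescribed bound, and [B] absorbs constants that may be built from [C];
    hence the order of the quantifiers. *)
Lemma relocate : exists2 K : nat, (0 < K)%N & forall beta : R, 0 < beta ->
  exists2 C, 1 <= C & forall B, 1 <= B -> exists2 eps : R, 0 < eps <= 1 &
  forall rho pi, 0 < rho <= eps -> exists v pi1,
    [/\ ratw d v <= ratw c v * ratw c pi1,
        ratw c v * ratw c pi1 <= C * ratw d v,
        C * ratw d v <= beta,
        (B * rho) ^+ K <= ratw d v &
        forall n,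
          (box_cover n (ratw c pi * rho) rho (colcell [::] pi) ->
           box_cover n (ratw c pi1 * rho) (2 * rho) (colcell [::] pi1)) /\
          (box_cover n (ratw c pi1 * rho) rho (colcell [::] pi1) ->
           box_cover n (ratw c pi * rho) (2 * rho) (colcell [::] pi))].
Proof.
have /andP[lam0 lam1] : 0 < lam < 1.
  rewrite (carpet_lam H); have [i _] := carpet_wide H.
  by have /andP[/le_lt_trans-> //] := carpet_c H i; exact: carpet_c_lt1 H i.
have [j dc] := carpet_wide H.
have muH := carpet_mu H; have /andP[mu0 mu1] := muH.
have cj0 := c0 j; have dj0 := d0 j.
have cj1 := carpet_c_lt1 H j; have dj1 := carpet_d_lt1 H j.
pose tau := d j / c j.
have tau0 : 0 < tau by rewrite divr_gt0.
have tau1 : tau < 1 by rewrite ltr_pdivrMr // mul1r.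
have djE : d j = tau * c j by rewrite divfK // gt_eqF.
have tau01 : 0 < tau < 1 by rewrite tau0.
(* [lam] is bounded below by a power of [mu], and [d j] by a power of [tau]; this controls widths
   and heights of words by powers of the scale. *)
have [K1 hK1] := exists_expr_le muH lam0.
have [K2 hK2] := exists_expr_le tau01 dj0.
exists (K1 * K2).+1 => // beta beta0.
(* [p0] extra letters [j] make the new square smaller than [beta]; they unbalance it by [tau ^+ p0],
   which [C] records with one more factor for rounding. *)
have [p0 hp0] : exists n, c j ^+ n <= beta * tau.
  by apply: exists_expr_le; rewrite ?cj0 // mulr_gt0.
exists (tau^-1 ^+ p0.+1); first by apply: exprn_ege1; rewrite invf_ge1 // ltW.
move=> B B1.
(* [k0] collects the constants of the lower bound for [ratw d v]; the surplus factor [rho] in the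
   exponent [(K1 * K2).+1] pays for them and for [B]. *)
pose k0 := d j ^+ p0 * (tau * mu ^+ K1) ^+ K2.
have k00 : 0 < k0 by rewrite mulr_gt0 ?exprn_gt0 // mulr_gt0 // exprn_gt0.
have k01 : k0 <= 1.
  apply: mulr_ile1; [exact/exprn_ge0/ltW| |exact: exprn_ile1 (ltW dj0) (ltW dj1)|].
    by apply/exprn_ge0/mulr_ge0; [exact: ltW|exact/exprn_ge0/ltW].
  apply: exprn_ile1; first by apply: mulr_ge0; [exact: ltW|exact/exprn_ge0/ltW].
  apply: mulr_ile1; [exact: ltW|exact/exprn_ge0/ltW|exact: ltW|].
  exact: exprn_ile1 (ltW mu0) (ltW mu1).
have BK : 1 <= B ^+ (K1 * K2).+1 by apply: exprn_ege1.
have BK0 := lt_le_trans ltr01 BK.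
exists (k0 / B ^+ (K1 * K2).+1).
  rewrite divr_gt0 //= ler_pdivrMr // mul1r; exact: le_trans k01 BK.
move=> rho pi /andP[rho0 rhoeps].
have rho1 : rho <= 1.
  by apply: le_trans rhoeps _; rewrite ler_pdivrMr // mul1r; exact: le_trans k01 BK.
(* After [n] letters cylinders have height at most [rho], while the width of the truncated word is
   still at least a power of [rho * mu]. *)
have [n [n1 n2]] : exists n, mu ^+ n <= rho /\ rho * mu <= mu ^+ n.
  by apply: exists_expr_scale; rewrite ?rho0.
pose pi1 := take n pi.
have W1gt0 : 0 < ratw c pi1 by apply: ratw_gt0.
have W1le1 : ratw c pi1 <= 1 by apply: ratw_le1 => // i; apply: carpet_c_lt1 H _.
have W1ge : (rho * mu) ^+ K1 <= ratw c pi1.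
  have h1 : lam ^+ size pi1 <= ratw c pi1.
    by apply: pow_le_ratw; rewrite ?ltW // => i; have /andP[] := carpet_c H i.
  apply: le_trans h1; apply: (@le_trans _ _ (lam ^+ n)); last first.
    by rewrite ler_wiXn2l ?ltW // size_take; case: ltnP => // /ltnW.
  apply: (@le_trans _ _ ((mu ^+ n) ^+ K1)).
    by rewrite lerXn2r // nnegrE ?exprn_ge0 ?mulr_ge0 ?ltW.
  by rewrite exprAC lerXn2r // nnegrE ?exprn_ge0 ?ltW.
(* Each letter [j] multiplies the ratio of height to width by [tau]; [p1] of them bring it down to
   the width of [pi1]. *)
have [p1 [p1a p1b]] : exists p, tau ^+ p <= ratw c pi1 /\ ratw c pi1 * tau <= tau ^+ p.
  by apply: exists_expr_scale; rewrite ?W1gt0.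
exists (nseq (p0 + p1) j), pi1; rewrite !ratw_nseq.
have cp0 : 0 < c j ^+ (p0 + p1) by rewrite exprn_gt0.
have dE : d j ^+ (p0 + p1) = tau ^+ p0 * tau ^+ p1 * c j ^+ (p0 + p1).
  by rewrite djE exprMn exprD.
have tp0 : 0 < tau ^+ p0 by rewrite exprn_gt0.
have tp1 : 0 < tau ^+ p1 by rewrite exprn_gt0.
have tp0' : tau ^+ p0 <= 1 by rewrite exprn_ile1 // ltW.
split.
- rewrite dE mulrC ler_pM2l //; apply: le_trans p1a.
  by rewrite ler_piMl // ltW.
- rewrite dE [leRHS](_ : _ = tau^-1 * tau ^+ p1 * c j ^+ (p0 + p1)); last first.
    by rewrite exprS exprVn; field; rewrite !gt_eqF.
  by rewrite mulrC ler_pM2r // mulrC ler_pdivlMr.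
- rewrite exprD {1}djE exprMn.
  rewrite [leLHS](_ : _ = tau^-1 * c j ^+ p0 * d j ^+ p1); last first.
    by rewrite exprS exprVn; field; rewrite !gt_eqF.
  apply: (@le_trans _ _ (tau^-1 * c j ^+ p0)).
    by rewrite ler_piMr ?exprn_ile1 ?ltW // mulr_gt0 ?exprn_gt0 ?invr_gt0.
  by rewrite mulrC ler_pdivrMr.
- apply: (@le_trans _ _ (k0 * rho ^+ (K1 * K2))).
    rewrite exprMn exprSr [in leLHS]exprSr -[X in X * _ <= _]exprSr.
    rewrite mulrCA mulrC ler_pM2r ?exprn_gt0 //.
    by rewrite mulrC -ler_pdivlMr.
  rewrite /k0 exprM -mulrA -exprMn -mulrA -[mu ^+ K1 * _]exprMn exprD ler_pM2l ?exprn_gt0 //.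
  apply: (@le_trans _ _ ((tau ^+ K2) ^+ p1)); last first.
    by rewrite lerXn2r // nnegrE ?exprn_ge0 ?ltW.
  have mr0 : 0 <= (mu * rho) ^+ K1 by apply/exprn_ge0/mulr_ge0; exact: ltW.
  have [tau0' tp1'] := (ltW tau0, ltW tp1).
  rewrite exprAC; apply: lerXn2r; rewrite ?nnegrE //; first exact: mulr_ge0.
  by apply: le_trans p1b; rewrite mulrC ler_pM2r // mulrC.
- move=> k.
  have short : drop n pi = [::] \/ mu ^+ size pi1 <= rho.
    have [np|np] := leqP (size pi) n; first by left; rewrite drop_oversize.
    by right; rewrite size_takel // ltnW.
  split => cov.
    apply: (cell_shorten H (ltW rho0) short); rewrite cat_take_drop //.
  by have := cell_lengthen H (ltW rho0) short cov; rewrite cat_take_drop.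
Qed.

(** [theta] is the ratio of the two radii; being at most [Rp] to the power [delta], it makes the
    pair admissible for [delta]. *)
Lemma relocate_scales (Rp theta delta : R) K : 0 < Rp <= 1 -> 0 < theta <= 1 ->
  theta ^+ K <= Rp -> 0 <= delta -> delta * K%:R <= 1 ->
  theta * Rp <= Rp `^ (1 + delta) /\ Rp `^ (1 + delta) <= Rp.
Proof.
move=> /andP[Rp0 Rp1] th thK dl0 dlK.
have RpE : Rp `^ (1 + delta) = Rp * Rp `^ delta.
  by rewrite powRD ?powRr1 ?ltW // (gt_eqF Rp0) implybT.
rewrite RpE mulrC; split; last first.
  rewrite ler_piMr ?(ltW Rp0) // -(powRr0 Rp).
  by apply: ger_powR => //; rewrite Rp0.
by rewrite ler_pM2l // (le_powR_of_expr th thK).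
Qed.

End Relocation.

(** * Transfer of exponents from [delta] to 0 on approximate squares *)

Definition upper_exponent (R : realType) (E : set (R * R)) (delta alpha bd k : R) :=
  forall r rho : R,
    0 < r -> r <= rho `^ (1 + delta) -> rho `^ (1 + delta) <= rho ->
    rho <= bd -> forall x, E x ->
    (covering_number r (E `&` euclidean_ball x rho)
       <= (k * (rho / r) `^ alpha)%:E)%E.

Definition lower_exponent (R : realType) (E : set (R * R)) (delta alpha bd k : R) :=
  forall r rho : R,
    0 < r -> r <= rho `^ (1 + delta) -> rho `^ (1 + delta) <= rho ->
    rho <= bd -> forall x, E x ->
    ((k * (rho / r) `^ alpha)%:E
       <= covering_number r (E `&` euclidean_ball x rho))%E.

Section Exponents.
Context {R : realType} {I : finType} (c d a b : I -> R) (E : set (R * R)).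
Context (lam mu x0 x1 y0 y1 eta : R) (zeta : R * R) (core : seq I).
Hypothesis H : column_carpet c d a b E lam mu x0 x1 y0 y1 eta zeta core.

Local Notation colcell := (colcell c d a b E).
Local Notation vcell := (vcell c d).
Local Notation Sw := (Sw c d a b).
Let c0 := carpet_c_gt0 H.
Let d0 := carpet_d_gt0 H.

Lemma dist_cell u pi p q : colcell u pi p -> colcell u pi q ->
  box (ratw c (u ++ pi)) (ratw d u) q p.
Proof.
move=> [w [e [cw Ee ->]]] [w' [e' [cw' Ee' ->]]]; split.
  rewrite /= !affw_cat (affw_col _ cw) (affw_col _ cw') -!affw_cat dist_affw //.
  rewrite ler_piMr //; first exact/ltW/ratw_gt0.
  by have [] := dist_carpet H Ee Ee'.
rewrite /= !affw_cat dist_affw // ler_piMr //; first exact/ltW/ratw_gt0.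
by have [] := dist_carpet H (Sw_carpet H w Ee) (Sw_carpet H w' Ee').
Qed.

Lemma dist_mark u pi p : colcell u pi p ->
  box (ratw c (u ++ pi)) (ratw d u) p (mark c d a b zeta u pi).
Proof.
move=> [w [e [cw Ee ->]]]; split.
  rewrite /= !affw_cat (affw_col _ cw) -!affw_cat dist_affw // ler_piMr //.
    exact/ltW/ratw_gt0.
  by have [] := dist_carpet H (carpet_zeta H) Ee.
rewrite /= !affw_cat dist_affw // ler_piMr //; first exact/ltW/ratw_gt0.
by have [] := dist_carpet H (carpet_zeta H) (Sw_carpet H w Ee).
Qed.

Lemma box_trans (r1 r2 s1 s2 : R) (x y z : R * R) :
  box r1 r2 x y -> box s1 s2 y z -> box (r1 + s1) (r2 + s2) x z.
Proof.
move=> [h1 h2] [k1 k2]; split.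
  by rewrite (le_trans (ler_distD y.1 _ _)) // addrC lerD.
by rewrite (le_trans (ler_distD y.2 _ _)) // addrC lerD.
Qed.

(** The cell is relocated into one ball of radius [Rp] around a point of [E], where the exponent
    applies; the cover obtained is pulled back by [v], passed from [pi1] to [pi] and pushed by
    [u]. *)
Lemma vcell_cover : exists2 K : nat, (0 < K)%N & forall delta alpha bd k : R,
  0 <= delta -> delta * K%:R <= 1 -> 0 < bd -> 0 < k ->
  upper_exponent E delta alpha bd k ->
  exists2 k', 0 < k' & forall (r rho : R) u pi, 0 < r -> r <= rho -> rho < 1 ->
    vcell rho u pi ->
    exists2 n, n%:R <= k' * (rho / r) `^ alpha & box_cover n (r / 2) (r / 2) (colcell u pi).
Proof.
have [K K0 reloc] := relocate H; exists K => //.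
move=> delta alpha bd k dl0 dlK bd0 k0 UE.
have [|C C1 relocC] := reloc (Num.min bd 1 / 2).
  by rewrite divr_gt0 // lt_min bd0 ltr01.
have [eps /andP[eps0 eps1] relocB] := relocC 1 (lexx _).
have C0 := lt_le_trans ltr01 C1.
(* The factor 4 turns the doubled boxes of the relocation into half-sides at most [r / 2]. *)
pose sig := eps / 4; have sig0 : 0 < sig by rewrite divr_gt0.
exists (2 * k * (2 * C / sig) `^ alpha).
  by rewrite !mulr_gt0 // powR_gt0 // divr_gt0 // mulr_gt0.
move=> r rho u pi r0 rrho rho1 [su sc].
have rho0 := lt_le_trans r0 rrho.
pose t := sig * (r / rho).
have rr0 : 0 < r / rho by rewrite divr_gt0.
have rr1 : r / rho <= 1 by rewrite ler_pdivrMr // mul1r.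
have t0 : 0 < t by rewrite mulr_gt0.
have tsig : t <= sig by rewrite ler_piMr // ltW.
have teps : 0 < t <= eps by rewrite t0 (le_trans tsig) // /sig; lra.
have [v [pi1 [dW WC Cb dvK cov]]] := relocB t pi teps.
have dv0 := ratw_gt0 d0 v; have cv0 := ratw_gt0 c0 v.
have W10 := ratw_gt0 c0 pi1; have W0 := ratw_gt0 c0 pi.
rewrite mul1r in dvK.
(* [C * ratw d v] bounds both sides of the cell of [v] and [pi1]; the 2 passes from boxes to
   Euclidean balls. *)
pose Rp := 2 * (C * ratw d v).
have Rpmin : Rp <= Num.min bd 1 by rewrite /Rp mulrC -ler_pdivlMr.
have [Rpb Rp1] : Rp <= bd /\ Rp <= 1.
  by move: Rpmin; rewrite le_min => /andP[].
have Rp0 : 0 < Rp by rewrite !mulr_gt0.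
pose theta := t / (2 * C).
have theta0 : 0 < theta by rewrite divr_gt0 // mulr_gt0.
have thetat : theta <= t by rewrite ler_pdivrMr ?mulr_gt0 // ler_peMr //; lra.
have t1 : t <= 1 by rewrite (le_trans tsig) // /sig; lra.
have thetaRp : theta * Rp = t * ratw d v.
  by rewrite /theta /Rp; field; rewrite gt_eqF.
have [|||sc1 sc2] := @relocate_scales _ Rp theta delta K _ _ _ dl0 dlK.
- by rewrite Rp0.
- by rewrite theta0 (le_trans thetat).
- apply: (@le_trans _ _ (t ^+ K)).
    by apply: lerXn2r => //; rewrite nnegrE ltW.
  apply: le_trans dvK _; rewrite /Rp mulrA ler_peMl ?(ltW dv0) //; lra.
have zE : E (Sw (v ++ pi1) zeta) := Sw_carpet H _ (carpet_zeta H).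
have trp0 : 0 < theta * Rp by rewrite mulr_gt0.
have := UE _ _ trp0 sc1 sc2 Rpb _ zE.
have -> : Rp / (theta * Rp) = 2 * C / sig * (rho / r).
  by rewrite /theta /t; field; rewrite !gt_eqF // mulr_gt0.
rewrite [(2 * C / sig * _) `^ _]powRM; [|by rewrite ltW // divr_gt0 // mulr_gt0|by rewrite ltW // divr_gt0].
set y := k * _ => hy.
have y0' : 0 < y by rewrite !mulr_gt0 // powR_gt0 // divr_gt0 // mulr_gt0.
(* Doubling [y] gives a strict inequality, hence an actual cover. *)
have : (covering_number (theta * Rp)
         (E `&` euclidean_ball (Sw (v ++ pi1) zeta) Rp) < (2 * y)%:E)%E.
  by apply: le_lt_trans hy _; rewrite lte_fin; lra.
move=> /covering_number_lt[n ny cn]; exists n.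
  by apply: le_trans (ltW ny) _; rewrite le_eqVlt; apply/orP; left; apply/eqP; rewrite /y; ring.
have cn1 : box_cover n (theta * Rp) (theta * Rp) (colcell v pi1).
  apply: box_cover_le cn => // p pv; split; first exact: (cell_sub H pv).
  apply: box_euclidean_ball; first by rewrite mulr_ge0 // ltW.
  apply: (box_le _ _ (dist_cell pv _)).
  - by rewrite ratw_cat.
  - by rewrite ler_peMl // ltW.
  - by exists pi1, zeta; split=> //; apply: carpet_zeta H.
have cn2 : box_cover n (ratw c pi1 * t) t (colcell [::] pi1).
  apply: (box_cover_le _ _ _ _ (cell_pull H cn1)) => //.
    by rewrite thetaRp ler_pdivrMr //; have := ler_wpM2l (ltW t0) dW; lra.
  by rewrite thetaRp mulfK // gt_eqF.
have := cell_push H u ((cov n).2 cn2).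
have tr : t <= r / rho / 4.
  by rewrite /t /sig mulrAC ler_pM2r // ler_piMl // ltW.
have tr4 : t * rho <= r / 4.
  by apply: le_trans (ler_wpM2r (ltW rho0) tr) _; rewrite mulrAC divfK ?gt_eqF.
apply: box_cover_le => //.
  rewrite mulrA -ratw_cat; have [le _] := sc.
  by have := ler_wpM2r (ltW t0) le; lra.
by have [le _] := su; have := ler_wpM2r (ltW t0) le; lra.
Qed.

(** A ball of radius [rho] meets boundedly many approximate squares of size [rho]: their marks lie
    in a box of size of order [rho], and each grid cell contains the mark of at most one square. *)
Lemma vcells_cover : exists2 K : nat, (0 < K)%N & forall delta alpha bd k : R,
  0 <= delta -> delta * K%:R <= 1 -> 0 < bd -> 0 < k ->
  upper_exponent E delta alpha bd k ->
  exists2 k', 0 < k' & forall (r rho : R) x, 0 < r -> r <= rho -> rho < 1 ->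
    exists2 n, n%:R <= k' * (rho / r) `^ alpha &
      box_cover n (r / 2) (r / 2)
        [set p | euclidean_ball x rho p /\
                 exists u pi, vcell rho u pi /\ colcell u pi p].
Proof.
have [K K0 cellcov] := vcell_cover; exists K => //.
move=> delta alpha bd k dl0 dlK bd0 k0 UE.
have [k' k'0 cover] := cellcov _ _ _ _ dl0 dlK bd0 k0 UE.
have /andP[eta0 eta1] := carpet_eta H; have lam0 := carpet_lam H.
pose L := (Num.truncn (2 / (eta * lam))).+1.
have LE : 2 / (eta * lam) <= L%:R by apply/ltW; exact: truncnS_gt.
exists (((2 * L).+1 ^ 2)%:R * k'); first by rewrite mulr_gt0 // ltr0n.
move=> r rho x r0 rrho rho1; have rho0 := lt_le_trans r0 rrho.
pose y := k' * (rho / r) `^ alpha.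
have y0' : 0 <= y by rewrite mulr_ge0 ?powR_ge0 // ltW.
(* A common integer bound, the covers of different cells having different sizes. *)
pose n := Num.truncn y.
have ny : n%:R <= y by have /andP[] := truncn_itv y0'.
exists ((2 * L).+1 ^ 2 * n)%N; first by rewrite natrM -mulrA ler_pM2l ?ltr0n.
pose s := eta * (lam * rho).
have s0 : 0 < s by rewrite !mulr_gt0.
have Ls : rho + rho <= L%:R * s.
  have -> : rho + rho = 2 / (eta * lam) * s.
    by rewrite /s; field; rewrite !gt_eqF.
  by rewrite ler_pM2r.
apply: (@box_cover_marks _ (fun p q => exists u pi,
   [/\ vcell rho u pi, colcell u pi p & q = mark c d a b zeta u pi]) L n s _ _ x) => //.
  move=> p [/euclidean_ball_box xp [u [pi [vu pu]]]].
  exists (mark c d a b zeta u pi); first by exists u, pi.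
  apply: (box_le Ls Ls); apply: box_trans xp _.
  by apply: box_le (dist_mark pu); have [[? _] [? _]] := vu.
move=> g.
have [[u [pi [vu gu]]]|none] :=
    pselect (exists u pi, vcell rho u pi /\ box s s g (mark c d a b zeta u pi)).
  have [n' n'y cov] := cover r rho u pi r0 rrho rho1 vu.
  apply: box_cover_le cov => //; first by rewrite truncn_ge_nat.
  move=> p [_ [_ [u' [pi' [vu' pu' ->]]] gu']].
  by rewrite (vcell_unique H rho0 rho1 vu vu' gu gu').
apply: box_cover_le (box_cover_set0 n (r / 2) (r / 2)) => //.
by move=> p [_ [_ [u [pi [vu _ ->]]] gu]]; apply: none; exists u, pi.
Qed.

(** The given cover also covers the approximate square, which is relocated to the cell of [v] and
    [core ++ pi1]. That cell contains all of [E] near its point [z], so the exponent at [z] bounds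
    the number of boxes from below. *)
Lemma vcell_lower : exists2 K : nat, (0 < K)%N & forall delta alpha bd k : R,
  0 <= delta -> delta * K%:R <= 1 -> 0 < bd -> 0 < k ->
  lower_exponent E delta alpha bd k ->
  exists2 k', 0 < k' & forall (r rho : R) x u pi, 0 < r -> r <= rho -> rho < 1 ->
    vcell (rho / 4) u pi -> colcell u pi x ->
    forall n, box_cover n r r (E `&` euclidean_ball x rho) ->
      k' * (rho / r) `^ alpha <= n%:R.
Proof.
have [K K0 reloc] := relocate H; exists K => //.
move=> delta alpha bd k dl0 dlK bd0 k0 LE.
have [|C C1 relocC] := reloc (Num.min bd 1).
  by rewrite lt_min bd0 ltr01.
have C0 := lt_le_trans ltr01 C1.
have /andP[eta0 eta1] := carpet_eta H; have lam0 := carpet_lam H.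
have kap0 := ratw_gt0 c0 core.
have kap1 : ratw c core <= 1 by apply: ratw_le1 => // i; apply: carpet_c_lt1 H i.
(* Half a lower bound for the margin of [z] inside its cell, in units of [ratw d v]; the prefix
   [core] shrinks widths by [ratw c core]. *)
pose h := eta * ratw c core / 2.
have ek0 : 0 < eta * ratw c core by rewrite mulr_gt0.
have h0 : 0 < h by rewrite divr_gt0.
have ek1 : eta * ratw c core <= 1 by rewrite mulr_ile1 // ltW.
have h1 : h <= 1 by rewrite /h; lra.
(* With this [B], [theta] below equals [h * (B * t)], so that [theta ^+ K] is at most
   [h * ratw d v]. *)
have [|eps /andP[eps0 eps1] relocB] := relocC (4 * C / h ^+ 2).
  rewrite ler_pdivlMr ?exprn_gt0 // mul1r (@le_trans _ _ 1) //; last by lra.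
  by rewrite exprn_ile1 // ltW.
(* [N] brings [t] below [eps] for every [r <= rho]; in return the cover is refined by [N]. *)
pose N := (Num.truncn (4 / (lam * eps))).+1.
have NE : 4 / (lam * eps) <= N%:R by apply/ltW; exact: truncnS_gt.
have N0 : 0 < N%:R :> R by rewrite ltr0n.
pose M := (#|I| ^ size core * (2 * N).+1 ^ 2)%N.
have M0 : (0 < M)%N.
  have [i _] := carpet_wide H; rewrite muln_gt0 !expn_gt0; apply/andP; split=> //.
  by apply/orP; left; apply/card_gt0P; exists i.
have M0' : 0 < M%:R :> R by rewrite ltr0n.
pose gam := h * lam * N%:R / (16 * C).
have gam0 : 0 < gam by rewrite divr_gt0 // !mulr_gt0.
exists (M%:R^-1 * k * gam `^ alpha).
  by rewrite !mulr_gt0 ?invr_gt0 // powR_gt0.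
move=> r rho x u pi r0 rrho rho1 [su sc] xu n cn.
have rho0 := lt_le_trans r0 rrho.
have rr0 : 0 < r / rho by rewrite divr_gt0.
have rr1 : r / rho <= 1 by rewrite ler_pdivrMr // mul1r.
pose t := 4 / lam / N%:R * (r / rho).
have t0 : 0 < t by rewrite mulr_gt0 // !divr_gt0.
have teps : t <= eps.
  apply: (@le_trans _ _ (4 / lam / N%:R)); first by rewrite ler_piMr // !divr_ge0 // ltW.
  rewrite ler_pdivrMr // -ler_pdivrMl // [leLHS](_ : _ = 4 / (lam * eps)) //.
  by field; rewrite !gt_eqF.
have [|v [pi1 [dW WC Cb dvK cov]]] := relocB t pi; first by rewrite t0.
have dv0 := ratw_gt0 d0 v; have cv0 := ratw_gt0 c0 v.
have W10 := ratw_gt0 c0 pi1; have W0 := ratw_gt0 c0 pi.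
have du0 := ratw_gt0 d0 u; have cu0 := ratw_gt0 c0 u.
have [Cb1 Cb2] : C * ratw d v <= bd /\ C * ratw d v <= 1.
  by move: Cb; rewrite le_min => /andP[].
have dvC : ratw d v <= C * ratw d v by rewrite ler_peMl // ltW.
have [dv1 dvb] := (le_trans dvC Cb2, le_trans dvC Cb1).
pose Rp := h * ratw d v.
have Rp0 : 0 < Rp by rewrite mulr_gt0.
have Rpd : Rp <= ratw d v by rewrite ler_piMl // ltW.
pose theta := 4 * C / h * t.
have theta0 : 0 < theta by rewrite mulr_gt0 // divr_gt0 // mulr_gt0.
have thetaK : theta ^+ K <= Rp.
  have thE : theta = h * (4 * C / h ^+ 2 * t).
    by rewrite /theta; field; rewrite gt_eqF.
  rewrite thE exprMn /Rp; apply: ler_pM => //.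
  - by rewrite exprn_ge0 // ltW.
  - apply: exprn_ge0; apply: mulr_ge0 (ltW t0); apply: divr_ge0; last by rewrite exprn_ge0 // ltW.
    by rewrite mulr_ge0 // ltW.
  - by rewrite -[leRHS]expr1 ler_wiXn2l // ltW.
have Rp1 : Rp <= 1 := le_trans Rpd dv1.
have theta1 : theta <= 1.
  have := le_trans thetaK Rp1; apply: contraTT; rewrite -!ltNge => th1.
  by rewrite exprn_egt1 // -lt0n.
have [||sc1 sc2] := @relocate_scales _ Rp theta delta K _ _ thetaK dl0 dlK.
- by rewrite Rp0.
- by rewrite theta0.
(* [core] moves the point away from the horizontal sides whatever [pi1] does to its height. *)
pose z := Sw (v ++ core ++ pi1) zeta.
have zE : E z := Sw_carpet H _ (carpet_zeta H).
have trp0 : 0 < theta * Rp by rewrite mulr_gt0.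
have := LE _ _ trp0 sc1 sc2 (le_trans Rpd dvb) _ zE.
have thetaRp : theta * Rp = 4 * C * t * ratw d v.
  by rewrite /theta /Rp; field; rewrite gt_eqF.
have -> : Rp / (theta * Rp) = gam * (rho / r).
  rewrite /theta /t /gam; field; rewrite !gt_eqF // mulr_gt0.
rewrite [(gam * _) `^ _]powRM; [|exact: ltW|by rewrite ltW // divr_gt0].
move=> lowc.
have sub : E `&` euclidean_ball z Rp `<=` colcell v (core ++ pi1).
  move=> p [Ep /euclidean_ball_box[hp1 hp2]].
  apply: (mem_cell_open H Ep).
  - have /andP[z0 z1] := carpet_zeta1 H.
    have e0 := affwB c a (v ++ core ++ pi1) zeta.1 x0.
    have e1 := affwB c a (v ++ core ++ pi1) x1 zeta.1.
    have Wv0 := ratw_gt0 c0 (v ++ core ++ pi1).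
    have RpW : Rp < ratw c (v ++ core ++ pi1) * eta.
      apply: (@lt_le_trans _ _ (eta * ratw c core * ratw d v)).
        by rewrite ltr_pM2r // /h; lra.
      rewrite !ratw_cat; have := ler_wpM2l (ltW ek0) dW; lra.
    have f0 : ratw c (v ++ core ++ pi1) * eta <= ratw c (v ++ core ++ pi1) * (zeta.1 - x0).
      by rewrite ler_pM2l //; lra.
    have f1 : ratw c (v ++ core ++ pi1) * eta <= ratw c (v ++ core ++ pi1) * (x1 - zeta.1).
      by rewrite ler_pM2l //; lra.
    by move: hp1; rewrite ler_norml /z /= => /andP[? ?]; lra.
  - have /andP[z0 z1] := carpet_core H (Sw_carpet H pi1 (carpet_zeta H)).
    rewrite /= in z0 z1.
    have zE2 : z.2 = affw d b v (affw d b core (affw d b pi1 zeta.2)).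
      by rewrite /z /= !affw_cat.
    have e0 := affwB d b v (affw d b core (affw d b pi1 zeta.2)) y0.
    have e1 := affwB d b v y1 (affw d b core (affw d b pi1 zeta.2)).
    have Rpd' : Rp < ratw d v * eta.
      rewrite mulrC ltr_pM2r //; apply: (@lt_le_trans _ _ (eta * ratw c core)).
        by rewrite /h; lra.
      by rewrite ler_piMr // ltW.
    have f0 : ratw d v * eta <= ratw d v * (affw d b core (affw d b pi1 zeta.2) - y0).
      by rewrite ler_pM2l //; lra.
    have f1 : ratw d v * eta <= ratw d v * (y1 - affw d b core (affw d b pi1 zeta.2)).
      by rewrite ler_pM2l //; lra.
    by move: hp2; rewrite ler_norml zE2 => /andP[? ?]; lra.
(* Sides at most [rho / 4] put the whole square inside the ball around its point [x]. *)
have cn1 : box_cover n r r (colcell u pi).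
  apply: box_cover_le cn => // p pu; split; first exact: (cell_sub H pu).
  have -> : rho = 2 * (rho / 2) by rewrite mulrCA divff ?mulr1.
  apply: box_euclidean_ball; first by rewrite divr_ge0 // ltW.
  by apply: box_le (dist_cell pu xu); have [[? _] [? _]] := (su, sc); lra.
have lc : forall i, lam <= c i by move=> i; have /andP[] := carpet_c H i.
have ld : forall i, lam <= d i by move=> i; have /andP[] := carpet_d H i.
have rho40 : 0 < rho / 4 by rewrite divr_gt0.
have rho41 : rho / 4 < 1 by lra.
have Nt : lam * (rho / 4) * (N%:R * t) = r.
  by rewrite /t; field; rewrite !gt_eqF.
have Nt0 : 0 < N%:R * t by rewrite mulr_gt0.
have cn2 : box_cover n (N%:R * (ratw c pi * t)) (N%:R * t) (colcell [::] pi).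
  apply: (box_cover_le _ _ _ _ (cell_pull H cn1)) => //.
    have := stops_gt c0 lam0 lc rho40 rho41 sc.
    rewrite ler_pdivrMr // ratw_cat -(ltr_pM2r Nt0) Nt => /ltW; lra.
  have := stops_gt d0 lam0 ld rho40 rho41 su.
  by rewrite ler_pdivrMr // -(ltr_pM2r Nt0) Nt => /ltW; lra.
have Wt0 : 0 < ratw c pi * t by rewrite mulr_gt0.
have := cell_push H v (cell_prefix H core _
  ((cov _).1 (box_cover_refine Wt0 t0 cn2))).
move=> cn3.
have : (covering_number (theta * Rp) (E `&` euclidean_ball z Rp) <= (M * n)%:R%:E)%E.
  apply: (covering_number_le trp0); apply: box_cover_le (cn3 _) => //.
  - by rewrite /M mulnA.
  - rewrite thetaRp; apply: (@le_trans _ _ (ratw c v * (ratw c pi1 * t))).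
      by rewrite ler_pM2l // ler_piMl // ltW // mulr_gt0.
    by have := ler_wpM2r (ltW t0) WC; lra.
  - by rewrite thetaRp; have := ler_wpM2l (ltW t0) dvC; lra.
  - by rewrite mulr_ge0 // ltW.
move=> /(le_trans lowc); rewrite lee_fin natrM => hn.
rewrite [leLHS](_ : _ = M%:R^-1 * (k * (gam `^ alpha * (rho / r) `^ alpha))); last first.
  by ring.
by rewrite ler_pdivrMl.
Qed.

End Exponents.

(** * Approximate squares of both orientations *)

Definition column_system (R : realType) (I : finType) (c d a b : I -> R)
    (E : set (R * R)) :=
  exists lam mu x0 x1 y0 y1 eta zeta core,
    column_carpet c d a b E lam mu x0 x1 y0 y1 eta zeta core.

Definition vertical (R : realType) (I : finType) (c d a b : I -> R)
    (E : set (R * R)) (rho : R) : set (R * R) :=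
  [set p | exists u pi, vcell c d rho u pi /\ colcell c d a b E u pi p].

Section Codes.
Context {R : realType} {I : finType} (c d a b : I -> R) (E : set (R * R)).
Hypothesis sys : column_system c d a b E.

(** The stopping times of height and width along a code of [p] are compared. The width can stop
    strictly first only if some letter has [c i < d i]; then the coordinates are exchanged. *)
Lemma column_system_vertical p rho : E p -> 0 < rho ->
  vertical c d a b E rho p \/
  vertical d c b a (transpose E) rho (p.2, p.1) /\ exists i, c i < d i.
Proof.
case: sys => lam [mu [x0 [x1 [y0 [y1 [eta [zeta [core H]]]]]]]] Ep rho0.
have [c0 d0] := (carpet_c_gt0 H, carpet_d_gt0 H).
have [n nrho] := exists_expr_le (carpet_mu H) rho0.
have [w [e [sw Ee pE]]] := carpet_code H n Ep.
have [k kw sk] : exists2 k, (k <= size w)%N & stops d rho (take k w).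
  apply: exists_stops; apply: le_trans nrho; rewrite -sw.
  by apply: ratw_le_pow => // i; have /andP[] := carpet_d H i.
have [l lw sl] : exists2 l, (l <= size w)%N & stops c rho (take l w).
  apply: exists_stops; apply: le_trans nrho; rewrite -sw.
  by apply: ratw_le_pow => // i; have /andP[] := carpet_c H i.
have split_word i j : (i <= j)%N -> take i w ++ drop i (take j w) = take j w.
  by move=> ij; rewrite -{1}(take_takel w ij) cat_take_drop.
have [kl|lk] := leqP k l.
  left; exists (take k w), (drop k (take l w)); split.
    by split=> //; rewrite split_word.
  exists (drop k (take l w)), (Sw c d a b (drop l w) e); split=> //.
    exact: (Sw_carpet H (drop l w) Ee).
  by rewrite split_word // -Sw_cat cat_take_drop.
right; split; last first.
  apply: contrapT => /forallNP nc; have dc i : d i <= c i.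
    by rewrite leNgt; apply/negP/nc.
  have [_ /(_ l)] := sk; rewrite size_takel // => /(_ lk).
  rewrite take_takel ?(ltnW lk) // ltNge => /negP; apply.
  have [+ _] := sl; apply: le_trans; rewrite /ratw.
  by apply: ler_prod => i _; rewrite dc ltW.
have lk' := ltnW lk.
exists (take l w), (drop l (take k w)); split.
  by split=> //; rewrite split_word.
pose e' := Sw c d a b (drop k w) e.
exists (drop l (take k w)), (e'.2, e'.1); split=> //.
  exact: (Sw_carpet H (drop k w) Ee).
by rewrite split_word // pE -{1 2}(cat_take_drop k w) !Sw_cat.
Qed.

End Codes.

(** Stated for arbitrary maps so that both orientations can be treated at once: without a column
    system the set to cover is empty. *)
Lemma vertical_cover (R : realType) (I : finType) (c d a b : I -> R) (E : set (R * R)) :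
  exists2 K : nat, (0 < K)%N & forall delta alpha bd k : R,
  0 <= delta -> delta * K%:R <= 1 -> 0 < bd -> 0 < k ->
  upper_exponent E delta alpha bd k ->
  exists2 k', 0 < k' & forall (r rho : R) x, 0 < r -> r <= rho -> rho < 1 ->
    exists2 n, n%:R <= k' * (rho / r) `^ alpha &
      box_cover n (r / 2) (r / 2)
        [set p | euclidean_ball x rho p /\
                 (column_system c d a b E /\ vertical c d a b E rho p)].
Proof.
have [sys|nsys] := pselect (column_system c d a b E).
  case: (sys) => lam [mu [x0 [x1 [y0 [y1 [eta [zeta [core H]]]]]]]].
  have [K K0 cov] := vcells_cover H; exists K => // delta alpha bd k dl dlK bd0 k0 UE.
  have [k' k'0 cov'] := cov _ _ _ _ dl dlK bd0 k0 UE; exists k' => // r rho x r0 rr rho1.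
  have [n ny cn] := cov' _ _ x r0 rr rho1; exists n => //.
  by apply: box_cover_le cn => // p [? [_ ?]].
exists 1%N => // delta alpha bd k _ _ _ _ _; exists 1 => // r rho x _ _ _.
exists 0%N; first by rewrite mul1r powR_ge0.
by apply: box_cover_le (box_cover_set0 0 (r / 2) (r / 2)) => // p [_ [/nsys]].
Qed.

Lemma vertical_lower (R : realType) (I : finType) (c d a b : I -> R) (E : set (R * R)) :
  exists2 K : nat, (0 < K)%N & forall delta alpha bd k : R,
  0 <= delta -> delta * K%:R <= 1 -> 0 < bd -> 0 < k ->
  lower_exponent E delta alpha bd k ->
  exists2 k', 0 < k' & forall (r rho : R) x, 0 < r -> r <= rho -> rho < 1 ->
    column_system c d a b E /\ vertical c d a b E (rho / 4) x ->
    forall n, box_cover n r r (E `&` euclidean_ball x rho) ->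
      k' * (rho / r) `^ alpha <= n%:R.
Proof.
have [sys|nsys] := pselect (column_system c d a b E).
  case: (sys) => lam [mu [x0 [x1 [y0 [y1 [eta [zeta [core H]]]]]]]].
  have [K K0 low] := vcell_lower H; exists K => // delta alpha bd k dl dlK bd0 k0 LE.
  have [k' k'0 low'] := low _ _ _ _ dl dlK bd0 k0 LE; exists k' => //.
  by move=> r rho x r0 rr rho1 [_ [u [pi [vu xu]]]]; apply: low' vu xu.
exists 1%N => // delta alpha bd k _ _ _ _ _; exists 1 => // r rho x _ _ _.
by move=> [/nsys].
Qed.

(** * Exchange of the coordinates *)

Section Transposition.
Context {R : realType} (E : set (R * R)).

Lemma transposeI (A B : set (R * R)) :
  transpose (A `&` B) = transpose A `&` transpose B.
Proof. by []. Qed.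

Lemma ball_transpose (x : R * R) (r : R) :
  transpose E `&` euclidean_ball x r = transpose (E `&` euclidean_ball (x.2, x.1) r).
Proof. by rewrite transposeI euclidean_ball_transpose. Qed.

Lemma upper_exponent_transpose (delta alpha bd k : R) :
  upper_exponent E delta alpha bd k -> upper_exponent (transpose E) delta alpha bd k.
Proof.
move=> UE r rho r0 h1 h2 h3 x Ex; rewrite ball_transpose covering_number_transpose.
exact: UE.
Qed.

Lemma lower_exponent_transpose (delta alpha bd k : R) :
  lower_exponent E delta alpha bd k -> lower_exponent (transpose E) delta alpha bd k.
Proof.
move=> LE r rho r0 h1 h2 h3 x Ex; rewrite ball_transpose covering_number_transpose.
exact: LE.
Qed.

End Transposition.

(** * Independence of [delta] near 0 and passage to the limit *)

Section DeltaIndependence.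
Context {R : realType} {I : finType} (c d a b : I -> R) (E : set (R * R)).
Hypothesis coded : forall p rho, E p -> 0 < rho ->
  (column_system c d a b E /\ vertical c d a b E rho p) \/
  (column_system d c b a (transpose E) /\
   vertical d c b a (transpose E) rho (p.2, p.1)).

Lemma powR_scale_gt0 (r rho delta : R) : 0 < r -> r <= rho `^ (1 + delta) ->
  rho `^ (1 + delta) <= rho -> [/\ 0 < rho, rho `^ (1 + 0) = rho & r <= rho].
Proof.
move=> r0 h1 h2; have rr := le_trans h1 h2; have rho0 := lt_le_trans r0 rr.
by split=> //; rewrite addr0 powRr1 // ltW.
Qed.

(** The exponent sets coincide: the points of a ball are split by orientation and the two covers
    joined. The bound on [delta] suits both [K] and [K']. *)
Lemma upper_h_locally_cst : exists2 dl0 : R, 0 < dl0 & forall delta : R,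
  0 < delta <= dl0 -> upper_h E delta = upper_h E 0.
Proof.
have [K K0 covV] := vertical_cover c d a b E.
have [K' K'0 covH] := vertical_cover d c b a (transpose E).
have KK0 : 0 < (K + K')%:R :> R by rewrite ltr0n addn_gt0 K0.
exists (K + K')%:R^-1; first by rewrite invr_gt0.
move=> delta /andP[/ltW dl0]; rewrite -[_^-1]mul1r ler_pdivlMr // natrD => dl1.
have dlK : delta * K%:R <= 1.
  by apply: le_trans dl1; rewrite ler_wpM2l // lerDl.
have dlK' : delta * K'%:R <= 1.
  by apply: le_trans dl1; rewrite ler_wpM2l // lerDr.
congr ereal_inf; congr image; apply/seteqP; split=> alpha /= [al0 [bd [k [bd0 k0 UE]]]].
  split=> //.
  have [k1 k10 cov1] := covV _ _ _ _ dl0 dlK bd0 k0 UE.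
  have [k2 k20 cov2] := covH _ _ _ _ dl0 dlK' bd0 k0 (upper_exponent_transpose UE).
  exists (1 / 2), (k1 + k2); split; rewrite ?addr_gt0 ?divr_gt0 //.
  move=> r rho r0 h1 h2 hrho x Ex; have [rho0 _ rrho] := powR_scale_gt0 r0 h1 h2.
  have rho1 : rho < 1 by lra.
  have [n1 ny1 cn1] := cov1 r rho x r0 rrho rho1.
  have [n2 ny2 cn2] := cov2 r rho (x.2, x.1) r0 rrho rho1.
  apply: (@le_trans _ _ (n1 + n2)%:R%:E); last first.
    by rewrite lee_fin natrD mulrDl lerD.
  apply: covering_number_le => //.
  apply: box_cover_le (box_coverU cn1 (box_cover_transpose
    (_ : box_cover n2 (r / 2) (r / 2) (transpose [set p | euclidean_ball x rho p /\
      (column_system d c b a (transpose E) /\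
        vertical d c b a (transpose E) rho (p.2, p.1))])))) => //.
    move=> p [Ep xp]; have [h|h] := coded Ep rho0; [left|right]; split=> //.
  apply: box_cover_le cn2 => // p [xp h]; split; last by case: p xp h.
  by rewrite -euclidean_ball_transpose /transpose /=; case: p xp h.
(* Conversely, pairs admissible for [delta] are admissible for 0, with the same constants. *)
split=> //; exists bd, k; split=> // r rho r0 h1 h2 h3 x Ex.
have [rho0 e rrho] := powR_scale_gt0 r0 h1 h2.
by apply: UE; rewrite ?e.
Qed.

(** One orientation at the centre [x] suffices for a lower bound, hence the minimum of the two
    constants. *)
Lemma lower_h_locally_cst : exists2 dl0 : R, 0 < dl0 & forall delta : R,
  0 < delta <= dl0 -> lower_h E delta = lower_h E 0.
Proof.
have [K K0 lowV] := vertical_lower c d a b E.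
have [K' K'0 lowH] := vertical_lower d c b a (transpose E).
have KK0 : 0 < (K + K')%:R :> R by rewrite ltr0n addn_gt0 K0.
exists (K + K')%:R^-1; first by rewrite invr_gt0.
move=> delta /andP[/ltW dl0]; rewrite -[_^-1]mul1r ler_pdivlMr // natrD => dl1.
have dlK : delta * K%:R <= 1.
  by apply: le_trans dl1; rewrite ler_wpM2l // lerDl.
have dlK' : delta * K'%:R <= 1.
  by apply: le_trans dl1; rewrite ler_wpM2l // lerDr.
congr ereal_sup; congr image; apply/seteqP; split=> alpha /= [al0 [bd [k [bd0 k0 LE]]]].
  split=> //.
  have [k1 k10 low1] := lowV _ _ _ _ dl0 dlK bd0 k0 LE.
  have [k2 k20 low2] := lowH _ _ _ _ dl0 dlK' bd0 k0 (lower_exponent_transpose LE).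
  exists (1 / 2), (Num.min k1 k2); split; rewrite ?lt_min ?k10 ?divr_gt0 //.
  move=> r rho r0 h1 h2 hrho x Ex; have [rho0 _ rrho] := powR_scale_gt0 r0 h1 h2.
  have rho1 : rho < 1 by lra.
  have rho40 : 0 < rho / 4 by rewrite divr_gt0.
  apply: le_covering_number => n cn.
  have [h|h] := coded Ex rho40.
    apply: le_trans (low1 _ _ _ r0 rrho rho1 h n cn).
    by rewrite ler_wpM2r ?powR_ge0 // ge_min lexx.
  apply: le_trans (low2 _ _ _ r0 rrho rho1 h n _).
    by rewrite ler_wpM2r ?powR_ge0 // ge_min lexx orbT.
  rewrite ball_transpose; apply: box_cover_transpose.
  by apply: box_cover_le cn => // p; rewrite /transpose /=; case: p; case: x {Ex h}.
split=> //; exists bd, k; split=> // r rho r0 h1 h2 h3 x Ex.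
have [rho0 e rrho] := powR_scale_gt0 r0 h1 h2.
by apply: LE; rewrite ?e.
Qed.

End DeltaIndependence.

Lemma lim_right_eq_cst (R : realType) (f : R -> \bar R) (dl0 : R) (l : \bar R) :
  0 < dl0 -> (forall delta, 0 < delta <= dl0 -> f delta = l) ->
  lim (f delta @[delta --> (0 : R)^'+]) = l.
Proof.
move=> dl00 fl; apply: lim_near_cst => //; near=> x; apply: fl.
by apply/andP; split; near: x; [exact: nbhs_right_gt|exact: nbhs_right_le].
Unshelve. all: by end_near. Qed.

Lemma quasi_dims_eq (R : realType) (I : finType) (c d a b : I -> R) (E : set (R * R)) :
  (forall p rho, E p -> 0 < rho ->
  (column_system c d a b E /\ vertical c d a b E rho p) \/
  (column_system d c b a (transpose E) /\
   vertical d c b a (transpose E) rho (p.2, p.1))) ->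
  quasi_assouad_dim E = assouad_dim E /\
  quasi_lower_assouad_dim E = lower_assouad_dim E.
Proof.
move=> coded.
have [dl dl0 upp] := upper_h_locally_cst coded.
have [dl' dl'0 low] := lower_h_locally_cst coded.
by split; [apply: lim_right_eq_cst dl0 upp|apply: lim_right_eq_cst dl'0 low].
Qed.

(** * Construction of the open box *)

Section Building.
Context {R : realType} {I : finType}.

(* Either some word maps [0, 1] into the open interval, or all the intervals
   s i [0, 1] + t i share an endpoint of [0, 1], so that no two of them are
   separated and the interval may be enlarged. *)
Lemma coordinate_box (s t : I -> R) : (forall i, 0 < s i < 1) ->
  (forall i, 0 <= t i /\ t i + s i <= 1) ->
  exists z0 z1 eta w,
    [/\ z0 <= 0 /\ 1 <= z1, 0 < eta <= 1,
        forall i, z0 <= s i * z0 + t i /\ s i * z1 + t i <= z1,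
        forall i j, t i + s i <= t j -> s i * z1 + t i <= s j * z0 + t j &
        forall x, 0 <= x <= 1 -> z0 + eta <= affw s t w x <= z1 - eta].
Proof.
move=> s01 t01.
have s0 i : 0 < s i by have /andP[] := s01 i.
have [[[i ti] [j tj]]|nexi] :=
    pselect ((exists i, 0 < t i) /\ exists j, t j + s j < 1).
  pose eta := Num.min (t i) (s i * (1 - (t j + s j))).
  have eta1 : eta <= t i by rewrite ge_min lexx.
  have eta2 : eta <= s i * (1 - (t j + s j)) by rewrite ge_min lexx orbT.
  exists 0, 1, eta, [:: i; j]; split=> //.
  - apply/andP; split; first by rewrite lt_min ti mulr_gt0 ?subr_gt0.
    by apply: le_trans eta1 _; have [_ ?] := t01 i; have := s0 i; lra.
  - by move=> k; have := t01 k; rewrite mulr0 mulr1; lra.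
  - by move=> k l; rewrite mulr0 mulr1; lra.
  move=> x /andP[x0 x1] /=.
  have e0 : 0 <= s j * x by rewrite mulr_ge0 // ltW.
  have e1 : s j * x <= s j by rewrite ler_piMr // ltW.
  have f0 : 0 <= s i * (s j * x + t j).
    by apply: mulr_ge0; [exact: ltW|have [? _] := t01 j; lra].
  have f1 : s i * (s j * x + t j) <= s i * (t j + s j).
    by rewrite ler_pM2l //; lra.
  by have [h0 h1] := t01 i; apply/andP; split; lra.
have none i j : ~ (t i + s i <= t j).
  move=> h; apply: nexi; split; first by exists j; have := s0 i; have := t01 i; lra.
  by exists i; have := s0 j; have := t01 j; lra.
exists (-1), 2, 1, [::]; split=> //=.
- by split; lra.
- by rewrite ltr01 lexx.
- by move=> i; have /andP[a1 a2] := s01 i; have [b1 b2] := t01 i; split; lra.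
- by move=> i j /none.
- by move=> x /andP[x0 x1]; apply/andP; split; lra.
Qed.

(** The words [wx] and [wy] push a point of [E] inside the box: [wx] acts last and keeps the
    horizontal margin, while the vertical one shrinks by [ratw d wx]. *)
Lemma column_system_of (c d a b : I -> R) (E : set (R * R)) :
  (forall i, 0 < c i < 1) -> (forall i, 0 < d i < 1) ->
  (forall i, 0 <= a i /\ a i + c i <= 1) ->
  (forall i, 0 <= b i /\ b i + d i <= 1) ->
  (forall i j, i != j ->
     ((c i, a i) = (c j, a j) /\ (b i + d i <= b j \/ b j + d j <= b i)) \/
     (a i + c i <= a j \/ a j + c j <= a i)) ->
  E `<=` @unit_square R -> E !=set0 ->
  (forall p, E p <-> exists i e, E e /\ p = (c i * e.1 + a i, d i * e.2 + b i)) ->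
  (exists i, d i < c i) ->
  column_system c d a b E.
Proof.
move=> c01 d01 a01 b01 sep E01 [e0 Ee0] inv wide.
have c0 i : 0 < c i by have /andP[] := c01 i.
have d0 i : 0 < d i by have /andP[] := d01 i.
have [x0 [x1 [etax [wx [[x00 x11] /andP[ex0 ex1] stx apx wxE]]]]] := coordinate_box c01 a01.
have [y0 [y1 [etay [wy [[y00 y11] /andP[ey0 ey1] sty apy wyE]]]]] := coordinate_box d01 b01.
have unit1 p : E p -> 0 <= p.1 <= 1 /\ 0 <= p.2 <= 1.
  by move=> /E01[]; rewrite /= !in_itv.
have SE w e : E e -> E (Sw c d a b w e).
  move=> Ee; elim: w => [|i w IH]; first by case: e Ee.
  by apply/inv; exists i, (Sw c d a b w e).
(* A lower bound for all ratios and for their distances to 1, so that [1 - lam] serves as [mu]. *)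
pose lam := \big[Num.min/1 / 2]_i
  Num.min (Num.min (c i) (1 - c i)) (Num.min (d i) (1 - d i)).
have lamle i : lam <= Num.min (Num.min (c i) (1 - c i)) (Num.min (d i) (1 - d i)).
  exact: bigmin_le.
have lam0 : 0 < lam.
  apply: lt_bigmin => [|i _]; first by rewrite divr_gt0.
  by rewrite !lt_min !subr_gt0 (andP (c01 i)).1 (andP (c01 i)).2 (andP (d01 i)).1 (andP (d01 i)).2.
have lam1 : lam < 1.
  by have [i _] := wide; have := lamle i; have := c01 i; rewrite !le_min; lra.
pose eta := Num.min etax (etay * ratw d wx).
have rwx0 := ratw_gt0 d0 wx.
have eta0 : 0 < eta by rewrite lt_min ex0 mulr_gt0.
have etaxle : eta <= etax by rewrite ge_min lexx.
have etayle : eta <= etay * ratw d wx by rewrite ge_min lexx orbT.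
have rwx1 : ratw d wx <= 1 by apply: ratw_le1 => // i; have /andP[] := d01 i.
have etayle' : eta <= etay by apply: le_trans etayle _; rewrite ler_piMr // ltW.
pose zeta := Sw c d a b (wx ++ wy) e0.
exists lam, (1 - lam), x0, x1, y0, y1, eta, zeta, wy; split => //.
- by apply/andP; split; lra.
- by move=> i; have := lamle i; rewrite !le_min => /andP[/andP[? ?] _]; apply/andP; split; lra.
- by move=> i; have := lamle i; rewrite !le_min => /andP[_ /andP[? ?]]; apply/andP; split; lra.
- move=> i j /sep[[-> [/apy h|/apy h]]|[/apx h|/apx h]].
  + by left; split=> //; left.
  + by left; split=> //; right.
  + by right; left.
  + by right; right.
- by move=> p /unit1[/andP[? ?] /andP[? ?]]; split; apply/andP; split; lra.
- exact: SE.
- by rewrite eta0; lra.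
- have [h _] := unit1 _ (SE wy e0 Ee0); have /andP[? ?] := wxE _ h.
  by rewrite /zeta Sw_cat; apply/andP; split; rewrite /=; rewrite /= in h *; lra.
- have [_ h] := unit1 _ Ee0; have /andP[h0 h1] := wyE _ h.
  have y01 : y0 <= y1 by lra.
  have k0 := affwB d b wx (affw d b wy e0.2) y0.
  have k1 := affwB d b wx y1 (affw d b wy e0.2).
  have l0 : etay * ratw d wx <= ratw d wx * (affw d b wy e0.2 - y0).
    by rewrite mulrC ler_pM2l //; lra.
  have l1 : etay * ratw d wx <= ratw d wx * (y1 - affw d b wy e0.2).
    by rewrite mulrC ler_pM2l //; lra.
  have /andP[m0 _] : y0 <= affw d b wx y0 <= y1.
    by apply: (affw_itv d0 sty); rewrite lexx.
  have /andP[_ m1] : y0 <= affw d b wx y1 <= y1.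
    by apply: (affw_itv d0 sty); rewrite lexx y01.
  by rewrite /zeta Sw_cat; apply/andP; split; rewrite /=; lra.
- move=> p /unit1[_ h]; have /andP[? ?] := wyE _ h.
  by apply/andP; split; lra.
Qed.

End Building.

(** * Cells of a subdivision *)

Section Partitions.
Context {R : realType}.

Lemma itv_partition_nth (s : seq R) j k : itv_partition 0 1 s ->
  (j <= k)%N -> (k <= size s)%N -> nth 0 (0 :: s) j <= nth 0 (0 :: s) k.
Proof.
move=> [ps _] jk ks.
have ss : sorted <=%R (0 :: s) by apply: sub_path ps => x y /ltW.
by apply: (sorted_leq_nth le_trans lexx _ ss); rewrite ?inE //= ltnS // (leq_trans jk).
Qed.

Lemma itv_partition_bounds (s : seq R) j : itv_partition 0 1 s ->
  (j < size s)%N -> 0 <= nth 0 (0 :: s) j /\ nth 0 s j <= 1.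
Proof.
move=> ps js; split; first exact: (itv_partition_nth ps (leq0n j) (ltnW js)).
have := itv_partition_nth ps js (leqnn _).
by have [_ /eqP <-] := ps; rewrite (last_nth 0).
Qed.

Lemma itv_partition_sep (s : seq R) j k : itv_partition 0 1 s ->
  (j < size s)%N -> (k < size s)%N -> j != k ->
  nth 0 s j <= nth 0 (0 :: s) k \/ nth 0 s k <= nth 0 (0 :: s) j.
Proof.
move=> ps js ks; rewrite neq_ltn => /orP[jk|kj]; [left|right].
  exact: (itv_partition_nth ps jk (ltnW ks)).
exact: (itv_partition_nth ps kj (ltnW js)).
Qed.

(** The images of two opposite corners lie in the cell, and two opposite corners of the cell lie in
    the image; this pins down all four sides. *)
Lemma diag_affine_cells (c d a b : R) (s t : seq R) (j k : nat) :
  0 < c -> 0 < d ->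
  diag_affine c d a b @` @unit_square R = cell s j `*` cell t k ->
  [/\ a = nth 0 (0 :: s) j, a + c = nth 0 s j,
      b = nth 0 (0 :: t) k & b + d = nth 0 t k].
Proof.
move=> c0 d0 eqi.
have in00 : (cell s j `*` cell t k) (a, b).
  by rewrite -eqi; exists (0, 0); rewrite /diag_affine /= ?mulr0 ?add0r //;
     split; rewrite /= in_itv /= lexx ler01.
have in11 : (cell s j `*` cell t k) (c + a, d + b).
  by rewrite -eqi; exists (1, 1); rewrite /diag_affine /= ?mulr1 //;
     split; rewrite /= in_itv /= lexx ler01.
move: in00 in11; rewrite /cell /= !in_itv /= => -[/andP[a1 a2] /andP[b1 b2]].
move=> [/andP[a3 a4] /andP[b3 b4]].
have corner z w : (cell s j `*` cell t k) (z, w) ->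
    [/\ a <= z, z <= c + a, b <= w & w <= d + b].
  rewrite -eqi => -[[x y] [/=]]; rewrite !in_itv /= => /andP[x0 x1] /andP[y0 y1].
  move=> [<- <-]; have := mulr_ge0 (ltW c0) x0; have := mulr_ge0 (ltW d0) y0.
  have : c * x <= c by rewrite ler_piMr // ltW.
  have : d * y <= d by rewrite ler_piMr // ltW.
  by move=> *; split; lra.
have [|p1 _ p2 _] := corner (nth 0 (0 :: s) j) (nth 0 (0 :: t) k).
  by rewrite /cell /= !in_itv /= !lexx (le_trans a1) // (le_trans b1).
have [|_ p3 _ p4] := corner (nth 0 s j) (nth 0 t k).
  by rewrite /cell /= !in_itv /= !lexx (le_trans a1) // (le_trans b1).
by split; lra.
Qed.

End Partitions.

(** * The two classes as column systems *)

Section Classes.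
Context {R : realType} {m : nat} (c d a b : 'I_m -> R) (E : set (R * R)).
Hypotheses (hc : forall i, 0 < c i < 1) (hd : forall i, 0 < d i < 1).
Hypothesis hE : is_attractor (fun i => diag_affine (c i) (d i) (a i) (b i)) E.
Hypothesis hE01 : E `<=` @unit_square R.

Lemma attractor_inv p : E p <->
  exists i e, E e /\ p = (c i * e.1 + a i, d i * e.2 + b i).
Proof.
have [_ _ EE] := hE; rewrite {1}EE; split=> [[i _ [e Ee <-]]|[i [e [Ee ->]]]].
  by exists i, e.
by exists i => //; exists e.
Qed.

Lemma attractor_inv_transpose p : transpose E p <->
  exists i e, transpose E e /\ p = (d i * e.1 + b i, c i * e.2 + a i).
Proof.
split=> [/attractor_inv[i [e [Ee [e2 e1]]]]|[i [e [Ee ->]]]].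
  by exists i, (e.2, e.1); case: p e1 e2 => /= ? ? -> ->; case: e Ee.
by apply/attractor_inv; exists i, (e.2, e.1).
Qed.

(** Injectivity of [sel] makes two maps differ in column or, within a column, in row; a map with
    distinct ratios is strictly wider than high. *)
Lemma lalley_gatzouras_system : extended_lalley_gatzouras_class c d a b ->
  (exists i, c i != d i) ->
  column_system c d a b E /\ forall i, d i <= c i.
Proof.
move=> [_ [s [t [sel [[ps _] pt selI selE]]]]] [i0 cd0].
have c0 i : 0 < c i by have /andP[] := hc i.
have d0 i : 0 < d i by have /andP[] := hd i.
have dc i : d i <= c i by have [] := selE i.
have coords i := let: And4 _ _ e _ := selE i in diag_affine_cells (c0 i) (d0 i) e.
have sz1 i : ((sel i).1 < size s)%N by have [] := selE i.
have sz2 i : ((sel i).2 < size (t (sel i).1))%N by have [] := selE i.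
split=> //; apply: column_system_of => //.
- move=> i; have [-> -> _ _] := coords i.
  by have [] := itv_partition_bounds ps (sz1 i).
- move=> i; have [_ _ -> ->] := coords i.
  by have [] := itv_partition_bounds (pt _ (sz1 i)) (sz2 i).
- move=> i j ij; have [ai ci bi di] := coords i; have [aj cj bj dj] := coords j.
  have [e1|ne1] := eqVneq (sel i).1 (sel j).1; last first.
    by right; rewrite ci cj ai aj; apply: itv_partition_sep.
  left; split.
    have aE : a i = a j by rewrite ai aj e1.
    have : a i + c i = a j + c j by rewrite ci cj e1.
    by rewrite aE => /addrI ->.
  rewrite di dj bi bj e1; apply: itv_partition_sep; first exact: pt.
  - by rewrite -e1.
  - exact: sz2.
  - apply: contraNneq ij => e2; apply/eqP/selI.
    by rewrite (surjective_pairing (sel i)) (surjective_pairing (sel j)) e1 e2.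
- by have [] := hE.
- exact: attractor_inv.
- by exists i0; rewrite lt_neqAle dc eq_sym cd0.
Qed.

(** Rows and columns enter symmetrically, so the same separation argument serves the carpet and its
    transpose. *)
Lemma baranski_systems : baranski_class c d a b ->
  ((exists i, d i < c i) -> column_system c d a b E) /\
  ((exists i, c i < d i) -> column_system d c b a (transpose E)).
Proof.
move=> [_ [s [t [sel [[ps _] [pt _] selI selE]]]]].
have c0 i : 0 < c i by have /andP[] := hc i.
have d0 i : 0 < d i by have /andP[] := hd i.
have coords i := let: And3 _ _ e := selE i in diag_affine_cells (c0 i) (d0 i) e.
have sz1 i : ((sel i).1 < size s)%N by have [] := selE i.
have sz2 i : ((sel i).2 < size t)%N by have [] := selE i.
have ac i : 0 <= a i /\ a i + c i <= 1.
  by have [-> -> _ _] := coords i; apply: itv_partition_bounds.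
have bd i : 0 <= b i /\ b i + d i <= 1.
  by have [_ _ -> ->] := coords i; apply: itv_partition_bounds.
have sepx i j : (sel i).1 != (sel j).1 -> a i + c i <= a j \/ a j + c j <= a i.
  have [ai ci _ _] := coords i; have [aj cj _ _] := coords j => ne.
  by rewrite ci cj ai aj; apply: itv_partition_sep.
have sepy i j : (sel i).2 != (sel j).2 -> b i + d i <= b j \/ b j + d j <= b i.
  have [_ _ bi di] := coords i; have [_ _ bj dj] := coords j => ne.
  by rewrite di dj bi bj; apply: itv_partition_sep.
have samex i j : (sel i).1 = (sel j).1 -> (c i, a i) = (c j, a j).
  have [ai ci _ _] := coords i; have [aj cj _ _] := coords j => e1.
  have aE : a i = a j by rewrite ai aj e1.
  have : a i + c i = a j + c j by rewrite ci cj e1.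
  by rewrite aE => /addrI ->.
have samey i j : (sel i).2 = (sel j).2 -> (d i, b i) = (d j, b j).
  have [_ _ bi di] := coords i; have [_ _ bj dj] := coords j => e1.
  have bE : b i = b j by rewrite bi bj e1.
  have : b i + d i = b j + d j by rewrite di dj e1.
  by rewrite bE => /addrI ->.
have sel_neq i j : i != j -> (sel i).1 != (sel j).1 \/ (sel i).2 != (sel j).2.
  move=> ij; have [e1|?] := eqVneq (sel i).1 (sel j).1; last by left.
  right; apply: contraNneq ij => e2; apply/eqP/selI.
  by rewrite (surjective_pairing (sel i)) (surjective_pairing (sel j)) e1 e2.
have [e0 Ee0] : E !=set0 by have [] := hE.
split=> wide; apply: column_system_of => //.
- move=> i j /sel_neq ij; have [e1|/sepx] := eqVneq (sel i).1 (sel j).1; last by right.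
  left; split; first exact: samex.
  by case: ij => [|/sepy //]; rewrite e1 eqxx.
- by exists e0.
- exact: attractor_inv.
- move=> i j /sel_neq ij; have [e1|/sepy] := eqVneq (sel i).2 (sel j).2; last by right.
  left; split; first exact: samey.
  by case: ij => [/sepx //|]; rewrite e1 eqxx.
- by move=> p /hE01[].
- by exists (e0.2, e0.1); case: e0 Ee0.
- exact: attractor_inv_transpose.
Qed.

End Classes.

Unset Implicit Arguments.

Theorem proposition8 (R : realType) (m : nat) (c d a b : 'I_m -> R)
    (E : set (R * R))
    (hc : forall i, 0 < c i < 1) (hd : forall i, 0 < d i < 1)
    (hcd : exists i, c i != d i)
    (hclass : extended_lalley_gatzouras_class c d a b \/
              baranski_class c d a b)
    (hE : is_attractor (fun i => diag_affine (c i) (d i) (a i) (b i)) E)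
    (hE01 : E `<=` @unit_square R) :
  quasi_assouad_dim E = assouad_dim E /\
  quasi_lower_assouad_dim E = lower_assouad_dim E.
Proof.
apply: (@quasi_dims_eq R _ c d a b E) => p rho Ep rho0.
case: hclass => [/(lalley_gatzouras_system hc hd hE hE01)/(_ hcd)[sys dc]|].
  (* All maps being at least as wide as high, the width never stops strictly first. *)
  have [?|[_ [i]]] := column_system_vertical sys Ep rho0; first by left.
  by rewrite ltNge dc.
move=> /(baranski_systems hc hd hE hE01)[sysV sysH].
have [wide|nwide] := pselect (exists i, d i < c i).
  have sys := sysV wide.
  by have [?|[? /sysH ?]] := column_system_vertical sys Ep rho0; [left|right].
(* Now no map is wider than high, and the transposed carpet takes the place of the carpet as in the
   first class. *)
have [i0 cd0] := hcd.
have sys : column_system d c b a (transpose E).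
  apply: sysH; exists i0; rewrite lt_neqAle cd0 /= leNgt; apply/negP => dc.
  by apply: nwide; exists i0.
have Ep' : transpose E (p.2, p.1) by case: p Ep.
have [?|[_ /nwide //]] := column_system_vertical sys Ep' rho0.
by right.
Qed.
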